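(* Let $\tilde u\in H^1(\mathbb S)$ with $\tilde u(0)=0$ and let $\tilde\rho\in H^0(\mathbb S)$ satisfy $\|\tilde u_x\|^2+\|\tilde\rho\|^2=4$. For $(t,x)\in[0,\infty)\times\mathbb S$ define $$\varphi(t,x)=\int_0^x\big(f^2(t,y)+g^2(t,y)\big)\,dy,\qquad f(t,x)=\cos t+\frac{\tilde u_x(x)}{2}\sin t,\qquad g(t,x)=\frac{\tilde\rho(x)}{2}\sin t,$$ and $$\varrho(t,x)=\tilde\rho(x)\int_0^t\frac{\chi_{\{\varphi_x(s,\cdot)>0\}}(x)}{\varphi_x(s,x)}\,ds .$$ Then: (i) For each $t\ge0$, $(\varphi(t,\cdot),\varrho(t,\cdot))\in\mathcal M^0_{AC}$. (ii) For each $t\ge0$, $(\varphi_t(t,\cdot),\varrho_t(t,\cdot))\in T_{(\varphi(t,\cdot),0)}\mathcal M^0_{AC}$. (iii) With $\lambda$ denoting Lebesgue measure on $\mathbb S$, for $t\ge0$, $$\left\langle\binom{\varphi_t}{\varrho_t},\binom{\varphi_t}{\varrho_t}\right\rangle^{\mathbb A}_{(\varphi(t,\cdot),0)}=\begin{cases}1,&\sin t=0,\\[1mm] 1-\dfrac{1}{\sin^2t}\,\lambda\big(\{\tilde u_x=-2\cot t\}\cap\{\tilde\rho=0\}\big),&\sin t\ne0.\end{cases}$$ In particular, the geodesic has constant energy almost everywhere: for a.e. $t\in[0,\infty)$, $$\left\langle\binom{\varphi_t(t)}{\varrho_t(t)},\binom{\varphi_t(t)}{\varrho_t(t)}\right\rangle^{\mathbb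 A}_{(\varphi(t,\cdot),0)}=\left\langle\binom{\varphi_t(0)}{\varrho_t(0)},\binom{\varphi_t(0)}{\varrho_t(0)}\right\rangle^{\mathbb A}_{(\mathrm{id},0)} .$$ (iv) The geodesic equation holds in the weak form $$\binom{\varphi_{tt}}{\varrho_{tt}}=\Gamma_{(\varphi,\varrho)}\big((\varphi_t,\varrho_t),(\varphi_t,\varrho_t)\big)\qquad\text{for a.e. }t\in[0,\infty)$$ (equality of the second components being understood a.e. on $\mathbb S$).
   Context: $\mathbb S=\mathbb R/\mathbb Z$, identified with $[0,1]$ with endpoints glued; $H^k(\mathbb S)$ are the $L^2$-based Sobolev spaces and $\|\cdot\|$ is the norm of $H^0(\mathbb S)=L^2(\mathbb S)$. $\chi_E$ is the indicator function of $E$; $\{h>0\}$ abbreviates $\{x\in\mathbb S: h(x)>0\}$, and similarly for other conditions. The integrand in the definition of $\varrho$ is taken to be $0$ where $\varphi_x(s,x)=0$, and $\varrho(t,x)=0$ where $\tilde\rho(x)=0$. $M^{AC}$ is the set of nondecreasing absolutely continuous functions $\varphi:[0,1]\to[0,1]$ with $\varphi(0)=0$ and $\varphi(1)=1$, and $\mathcal M^0_{AC}=M^{AC}\times H^0(\mathbb S)$ (as a set; it is viewed as a semidirect product with multiplication $(\varphi,f)(\psi,g)=(\varphi\circ\psi,\,g+f\circ\psi)$). Its tangent space at $(\mathrm{id},0)$ is $\{u\in H^1(\mathbb S):u(0)=0\}\times H^0(\mathbb S)$. For $\varphi\in M^{AC}$, the tangent space $T_{(\varphi,0)}\mathcal M^0_{AC}$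 is the set of pairs $(U,F)$ for which there exist $u\in H^1(\mathbb S)$ with $u(0)=0$ and $\rho\in H^0(\mathbb S)$ such that $U=u\circ\varphi$ and $F=\rho\circ\varphi$ a.e. (for some representative of $\rho$). For $\varphi\in M^{AC}$ put $N=\{x\in\mathbb S:\varphi_x(x)\text{ exists and equals }0\}$. For $(U,F),(V,G)\in T_{(\varphi,0)}\mathcal M^0_{AC}$, $$\langle(U,F),(V,G)\rangle^{\mathbb A}_{(\varphi,0)}=\frac14\int_{\mathbb S\setminus N}\Big(\frac{U_xV_x}{\varphi_x}+FG\,\varphi_x\Big)dx .$$ Christoffel operator: at the identity, for $u\in H^1(\mathbb S)$ with $u(0)=0$ and $\rho\in H^0(\mathbb S)$, $\Gamma_{(\mathrm{id},0)}((u,\rho),(u,\rho))=(\Gamma^{(1)},\Gamma^{(2)})$ with $$\Gamma^{(1)}(x)=\frac12\int_0^x(u_x^2+\rho^2)\,dy-\frac x2\int_{\mathbb S}(u_x^2+\rho^2)\,dy,\qquad \Gamma^{(2)}=-u_x\rho .$$ It is extended by right translation: if $U=u\circ\varphi$ and $F=\rho\circ\varphi$, then $\Gamma_{(\varphi,\varrho)}((U,F),(U,F))=(\Gamma^{(1)}\circ\varphi,\ \Gamma^{(2)}\circ\varphi)$. *)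

(* Defs.v *)
From HB Require Import structures.
From mathcomp Require Import all_boot all_order all_algebra.
From mathcomp Require Import all_classical all_reals all_analysis.

Set Implicit Arguments.
Unset Strict Implicit.
Unset Printing Implicit Defensive.

Import Order.TTheory GRing.Theory Num.Theory.
Import numFieldNormedType.Exports.

Local Open Scope classical_set_scope.
Local Open Scope ring_scope.

(* The circle S = R/Z is represented by `[0, 1]; a function on S is a function
   R -> R of which only the values on `[0, 1] are used.  The derivatives
   [derive1 f] in the space variable are two-sided, hence they may depend on the
   values off `[0, 1] only at the two end points, a null set. *)

Section circle.
Context {R : realType}.
Local Notation mu := (@lebesgue_measure R).

Definition aeS (P : R -> Prop) : Prop :=
  {ae mu, forall x, x \in `[0, 1] -> P x}.

(* The measurable sets of R are the Borel sets in the library, so "f has an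
   L^2 Borel representative" means that f is Lebesgue measurable and square
   integrable.  The library integral of such an f, a supremum over Borel simple
   functions, is its Lebesgue integral even if f itself is not Borel; likewise
   [lebesgue_measure] is an outer measure on arbitrary sets, which on Lebesgue
   measurable sets is the Lebesgue measure. *)
Definition H0 (f : R -> R) : Prop :=
  exists g : R -> R,
    [/\ measurable_fun (`[0, 1] : set R) g,
        mu.-integrable (`[0, 1] : set R) (fun x => (g x ^+ 2)%:E)
      & aeS (fun x => f x = g x)].

Definition sqnormH0 (f : R -> R) : R := \int[mu]_(x in `[0, 1]) (f x ^+ 2).

Definition C1S (psi : R -> R) : Prop :=
  [/\ forall x, psi (x + 1) = psi x,
      forall x, derivable psi x 1
    & continuous (derive1 psi : R -> R)].

(* In dimension one C^1 test functions define the same weak derivative as smooth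
   ones. *)
Definition weak_derivative (u v : R -> R) : Prop :=
  forall psi, C1S psi ->
    \int[mu]_(x in `[0, 1]) (u x * derive1 psi x) =
    - \int[mu]_(x in `[0, 1]) (v x * psi x).

(* u is the continuous representative of an element of H^1(S), and v is a
   representative of its weak derivative u_x. *)
Definition H1 (u v : R -> R) : Prop :=
  [/\ {within `[0, 1], continuous u}, u 0 = u 1, H0 v & weak_derivative u v].

Definition absolutely_continuous (f : R -> R) : Prop :=
  forall e : R, 0 < e -> exists2 d : R, 0 < d &
    forall (n : nat) (a b : 'I_n -> R),
      (forall i, 0 <= a i /\ a i <= b i /\ b i <= 1) ->
      (forall i j, i != j -> b i <= a j \/ b j <= a i) ->
      \sum_(i < n) (b i - a i) < d ->
      \sum_(i < n) `|f (b i) - f (a i)| < e.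

Definition MAC (phi : R -> R) : Prop :=
  [/\ forall x, x \in `[0, 1] -> phi x \in `[0, 1],
      {in `[0, 1] &, {homo phi : x y / x <= y}},
      absolutely_continuous phi,
      phi 0 = 0
    & phi 1 = 1].

Definition M0AC (phi vrho : R -> R) : Prop := MAC phi /\ H0 vrho.

(* (U, F) is the right translate by phi of the tangent vector (u, rho) at the
   identity, where u_x = v. *)
Definition right_translate (phi U F u v rho : R -> R) : Prop :=
  [/\ H1 u v, u 0 = 0, H0 rho,
      forall x, x \in `[0, 1] -> U x = u (phi x)
    & aeS (fun x => F x = rho (phi x))].

Definition tangent (phi U F : R -> R) : Prop :=
  exists u v rho : R -> R, right_translate phi U F u v rho.

Definition critical_set (phi : R -> R) : set R :=
  [set x | [/\ x \in `[0, 1], derivable phi x 1 & derive1 phi x = 0]].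

(* Valued in the extended reals, so that an equation with a real right-hand
   side includes the finiteness of the integral. *)
Definition metricA (phi U F V G : R -> R) : \bar R :=
  ((4^-1)%:E * \int[mu]_(x in (`[0%R, 1%R] `\` critical_set phi)%classic)
     (derive1 U x * derive1 V x / derive1 phi x + F x * G x * derive1 phi x)%:E)%E.

Definition Gamma1 (v rho : R -> R) (x : R) : R :=
  2^-1 * \int[mu]_(y in `[0, x]) (v y ^+ 2 + rho y ^+ 2)
  - x / 2 * \int[mu]_(y in `[0, 1]) (v y ^+ 2 + rho y ^+ 2).

Definition Gamma2 (v rho : R -> R) (x : R) : R := - (v x * rho x).

(* (A, B) = Gamma_(phi, vrho) ((U, F), (U, F)), which does not involve vrho.
   When phi is critical on a set of positive measure, the function
   [Gamma2 v rho \o phi] may depend, even up to null sets, on the chosen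
   representatives v and rho; the equality is required for all of them. *)
Definition christoffel_eq (phi U F A B : R -> R) : Prop :=
  tangent phi U F /\
  forall u v rho, right_translate phi U F u v rho ->
    (forall x, x \in `[0, 1] -> A x = Gamma1 v rho (phi x)) /\
    aeS (fun x => B x = Gamma2 v rho (phi x)).

(* Derivatives in time, for functions on [0, +oo[ : two-sided at t > 0 and
   right-sided at t = 0. *)
Definition time_quotient (f : R -> R) (t h : R) : R := h^-1 * (f (h + t) - f t).

Definition tderivable (f : R -> R) (t : R) : Prop :=
  cvg (time_quotient f t h @[h --> within [set h | 0 <= h + t] 0^']).

Definition Dt (f : R -> R) (t : R) : R :=
  lim (time_quotient f t h @[h --> within [set h | 0 <= h + t] 0^']).

(* The geodesic with initial velocity (u, rho); v stands for u_x. *)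
Definition geo_f (v : R -> R) (t x : R) : R := cos t + v x / 2 * sin t.

Definition geo_g (rho : R -> R) (t x : R) : R := rho x / 2 * sin t.

Definition geo_phi (v rho : R -> R) (t x : R) : R :=
  \int[mu]_(y in `[0, x]) (geo_f v t y ^+ 2 + geo_g rho t y ^+ 2).

Definition geo_phi_x (v rho : R -> R) (t : R) : R -> R :=
  derive1 (geo_phi v rho t).

Definition geo_integrand (v rho : R -> R) (x s : R) : R :=
  \1_[set y | 0 < geo_phi_x v rho s y] x / geo_phi_x v rho s x.

Definition geo_vrho (v rho : R -> R) (t x : R) : R :=
  rho x * \int[mu]_(s in `[0, t]) geo_integrand v rho x s.

Definition geo_phi_t (v rho : R -> R) (t x : R) : R :=
  Dt (fun s => geo_phi v rho s x) t.

Definition geo_vrho_t (v rho : R -> R) (t x : R) : R :=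
  Dt (fun s => geo_vrho v rho s x) t.

Definition geo_phi_tt (v rho : R -> R) (t x : R) : R :=
  Dt (fun s => geo_phi_t v rho s x) t.

Definition geo_vrho_tt (v rho : R -> R) (t x : R) : R :=
  Dt (fun s => geo_vrho_t v rho s x) t.

Definition geo_energy (v rho : R -> R) (t : R) : \bar R :=
  metricA (geo_phi v rho t) (geo_phi_t v rho t) (geo_vrho_t v rho t)
          (geo_phi_t v rho t) (geo_vrho_t v rho t).

End circle.

(* Main.v *)
(* Write f = cos t + (v / 2) sin t, g = (rho / 2) sin t.  For almost every x the
   derivative phi_x(t, x) = f^2 + g^2 exists for all t at once, and
   phi_xt^2 + rho^2 = 4 (f^2 + g^2) (f_t^2 + g_t^2), where f_t^2 + g_t^2 has
   integral 1.  Hence where phi_x > 0 the energy density is f_t^2 + g_t^2, while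
   phi_x = 0 forces rho = 0, v = - 2 cot t and f_t^2 + g_t^2 = 1 / sin^2 t.
   As vrho / 2 is the angle swept by f + i g, it is bounded by t + pi.
   The push-forward of phi_x dx by phi is Lebesgue measure; since a point with
   phi_x > 0 is alone on its level set, phi_xt / phi_x and rho / phi_x factor
   through phi, and the first factor is the weak derivative of the Eulerian
   velocity.  For fixed x, phi_x vanishes for countably many t only, so by Fubini
   phi_x(t, .) > 0 almost everywhere for almost every t; then null sets pull back
   to null sets, and the Christoffel operator does not depend on the chosen
   representatives. *)

Require Import Defs.
From HB Require Import structures.
From mathcomp Require Import all_boot all_order all_algebra.
From mathcomp Require Import all_classical all_reals all_analysis measurable_realfun.
From mathcomp Require Import ring lra.

Import Order.TTheory GRing.Theory Num.Theory.
Import numFieldNormedType.Exports.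

Local Open Scope classical_set_scope.
Local Open Scope ring_scope.

(** * Integrals of Lebesgue measurable functions *)

(** Three obstacles shape the proof. First, [v] and [rho] agree with Borel functions only almost
    everywhere, while integration lemmas usually ask for measurability. The computations are
    therefore made with Borel representatives [v0] and [r0] that vanish off the unit interval, and
    integrals are compared by lemmas that assume no measurability. Second, [geo_vrho] integrates in
    time at fixed [x], so an exceptional null set varying with the time would be useless. The three
    relevant densities are combinations of 1, [v0] and [v0]^2 + [r0]^2 with coefficients depending
    on time only: one null set then serves all times, and time derivatives of the primitives require
    no differentiation under the integral. Third, phi need not be injective. A supremum of sublevel
    sets replaces its inverse, and independence of representatives rests on the uniqueness of weak
    derivatives, proved with arctangents of trigonometric polynomials as test functions. The
    constant 4, together with the vanishing mean of [v], is what gives phi_x and f_t^2 + g_t^2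
    integral 1 at every time. *)

Section ae_integral.
Local Open Scope ereal_scope.
Context d (T : measurableType d) (R : realType) (m : {measure set T -> \bar R}).
Import HBNNSimple.

(** The integral is a supremum over simple functions below the integrand. Setting such a function to
    0 on the exceptional null set keeps its integral and puts it below [g] everywhere, so neither
    [f] nor [g] has to be measurable. *)
Lemma ge0_ae_le_integralT (f g : T -> \bar R) :
  (forall x, 0 <= f x) -> (forall x, 0 <= g x) ->
  {ae m, forall x, f x <= g x} -> \int[m]_x f x <= \int[m]_x g x.
Proof.
move=> f0 g0 [N [mN N0 fg]]; rewrite [leLHS]ge0_integralTE// [leRHS]ge0_integralTE//.
apply: ge_ereal_sup => _ [h /= hf <-].
pose h' := proj_nnsfun h (measurableC mN).
have -> : sintegral m h = sintegral m h'.
  rewrite -!integralT_nnsfun; apply: ge0_ae_eq_integral => //.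
  - exact/measurable_EFinP.
  - exact/measurable_EFinP.
  - by move=> x _; rewrite lee_fin.
  - by move=> x _; rewrite lee_fin.
  - exists N; split => // x /=; apply: contra_notP => Nx _ /=.
    by rewrite /h' /= mindicE mem_set// mulr1.
apply: ereal_sup_ubound; exists h' => // x /=.
rewrite /h' /= mindicE; case: (boolP (x \in ~` N)) => [|_]; last by rewrite mulr0.
rewrite inE/= => Nx; rewrite mulr1 (le_trans (hf x))//.
by apply: contra_notT Nx => /negP fgx; apply: fg.
Qed.

(* No measurability is required, hence this applies to functions that are only
   Lebesgue measurable. *)
Lemma ae_restrict_eq_integral (D D' : set T) (f g : T -> \bar R) :
  {ae m, forall x, (f \_ D) x = (g \_ D') x} ->
  \int[m]_(x in D) f x = \int[m]_(x in D') g x.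
Proof.
move=> fg.
have H (h k : T -> \bar R) : (forall x, 0 <= h x) -> (forall x, 0 <= k x) ->
    {ae m, forall x, h x = k x} -> \int[m]_x h x = \int[m]_x k x.
  move=> h0 k0 hk; apply/eqP; rewrite eq_le; apply/andP; split;
    by apply: ge0_ae_le_integralT => //; apply: filterS hk => x ->.
rewrite [LHS]integral_mkcond [RHS]integral_mkcond.
rewrite [LHS]integralE [RHS]integralE; congr (_ - _); apply: H => //;
  by apply: filterS fg => x fgx; rewrite ?funeposE ?funenegE fgx.
Qed.

Lemma ae_eq_integral_nonmeas (D : set T) (f g : T -> \bar R) :
  {ae m, forall x, D x -> f x = g x} ->
  \int[m]_(x in D) f x = \int[m]_(x in D) g x.
Proof.
move=> fg; apply: ae_restrict_eq_integral; apply: filterS fg => x fgx.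
by rewrite /patch; case: ifPn => //; rewrite inE.
Qed.

Lemma ae_eq_Rintegral_nonmeas (D : set T) (f g : T -> R) :
  {ae m, forall x, D x -> f x = g x} ->
  (\int[m]_(x in D) f x = \int[m]_(x in D) g x)%R.
Proof.
move=> fg; congr fine; apply: ae_eq_integral_nonmeas.
by apply: filterS fg => x fgx /fgx ->.
Qed.

End ae_integral.

Section lebesgue_ae.
Context {R : realType}.
Local Notation mu := (@lebesgue_measure R).
Implicit Types P Q S : R -> Prop.

#[local] Instance ae_lebesgue_filter : Filter (almost_everywhere mu).
Proof. exact: (ae_filter_ringOfSetsType mu). Qed.

Lemma ae_and P Q : {ae mu, forall x, P x} -> {ae mu, forall x, Q x} ->
  {ae mu, forall x, P x /\ Q x}.
Proof. exact: filterI. Qed.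

Lemma ae_mono P Q : (forall x, P x -> Q x) ->
  {ae mu, forall x, P x} -> {ae mu, forall x, Q x}.
Proof. exact: filterS. Qed.

Lemma ae_mono2 P Q S : (forall x, P x -> Q x -> S x) ->
  {ae mu, forall x, P x} -> {ae mu, forall x, Q x} -> {ae mu, forall x, S x}.
Proof. exact: filterS2. Qed.

Lemma ae_all P : (forall x, P x) -> {ae mu, forall x, P x}.
Proof. by move=> h; exact: aeW. Qed.

Lemma ae_neq (a : R) : {ae mu, forall x, x <> a}.
Proof.
exists [set a]; split => //=; first exact: lebesgue_measure_set1.
by move=> x /= /contrapT.
Qed.

(** Monotonicity and subadditivity of the outer measure suffice, so the sets may be non-Borel, as
    sets defined through [v] and [rho] can be. *)
Lemma le_lebesgue_measure_ae (A B : set R) :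
  {ae mu, forall x, A x -> B x} -> (mu A <= mu B)%E.
Proof.
move=> [N [mN N0 AB]].
have -> : mu B = (mu B + mu N)%E by rewrite N0 adde0.
apply: (@le_trans _ _ (mu (B `|` N))).
  apply: le_mu_ext => x Ax; have [Nx|Nx] := pselect (N x); first by right.
  by left; apply: contra_notP Nx => nB; apply: AB => /= /(_ Ax).
exact: outer_measureU2.
Qed.

Lemma lebesgue_measure_ae (A B : set R) :
  {ae mu, forall x, A x <-> B x} -> mu A = mu B.
Proof.
move=> AB; apply/eqP; rewrite eq_le; apply/andP; split;
  by apply: le_lebesgue_measure_ae; apply: ae_mono AB => x [].
Qed.

End lebesgue_ae.

(** * Time derivatives *)

Section time_derivative.
Context {R : realType}.
Implicit Types (f g : R -> R) (t l : R).

Let time_filter_proper t : 0 <= t ->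
  ProperFilter (within [set h | 0 <= h + t] (0 : R)^').
Proof.
move=> t0; apply: Build_ProperFilter => -[e /= e0 h].
have := h (e / 2); rewrite /ball/= sub0r normrN gtr0_norm ?divr_gt0//.
have e20 : 0 < e / 2 by rewrite divr_gt0.
apply => //; first by rewrite gtr_pMr// invf_lt1// ltr1n.
  by rewrite gt_eqF.
by rewrite addr_ge0// ltW.
Qed.

(** Here [g] is an extension of [f] to all times that is differentiable in the usual two-sided
    sense. The restricted filter only sees times [h + t >= 0], where both functions agree, so
    [t = 0] needs no separate treatment. *)
Lemma time_quotient_cvg f g t l : 0 <= t ->
  (forall s, 0 <= s -> f s = g s) -> is_derive t 1 g l ->
  time_quotient f t h @[h --> within [set h | 0 <= h + t] 0^'] --> l.
Proof.
move=> t0 fg dg.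
have /cvg_ex[l' gl'] := @ex_derive _ _ _ _ _ _ _ dg.
have ll' : l' = l by rewrite -(@derive_val _ _ _ _ _ _ _ dg); apply/esym/cvg_lim.
rewrite -{}ll' {l dg}.
apply: (cvg_trans _ (cvg_trans (cvg_app _ (@cvg_within _ _ _ [set h | 0 <= h + t])) gl')).
apply: near_eq_cvg; apply: filterS (@withinT _ _ _ _) => h /= ht.
by rewrite /time_quotient !fg// [h *: 1]mulr1.
Qed.

Lemma tderivable_is_derive f g t l : 0 <= t ->
  (forall s, 0 <= s -> f s = g s) -> is_derive t 1 g l -> tderivable f t.
Proof.
by move=> t0 fg dg; apply/cvg_ex; exists l; exact: time_quotient_cvg fg dg.
Qed.

Lemma Dt_is_derive f g t l : 0 <= t ->
  (forall s, 0 <= s -> f s = g s) -> is_derive t 1 g l -> Dt f t = l.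
Proof.
move=> t0 fg dg; have := time_filter_proper t t0 => pf.
by apply/cvg_lim; [exact: Rhausdorff|exact: time_quotient_cvg fg dg].
Qed.

End time_derivative.

(** * Monotone change of variables *)

Section integral_density.
Local Open Scope ereal_scope.
Context d (T : measurableType d) (R : realType) (m : {measure set T -> \bar R}).
Context d' (Y : measurableType d') (nu : {measure set Y -> \bar R}).
Import HBNNSimple.

(** The hypothesis on sets is the formula for indicators; linearity extends it to simple functions
    and monotone convergence to [f]. *)
Lemma ge0_integral_image_density (D : set Y) (phi : T -> Y) (g : T -> \bar R)
    (f : Y -> \bar R) :
  measurable D -> measurable_fun setT phi -> measurable_fun setT g ->
  (forall x, 0 <= g x) ->
  (forall A, measurable A -> nu (A `&` D) = \int[m]_(x in phi @^-1` A) g x) ->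
  measurable_fun setT f -> (forall y, 0 <= f y) ->
  \int[nu]_(y in D) f y = \int[m]_x (f (phi x) * g x).
Proof.
move=> mD mphi mg g0 nuE mf f0.
pose h := nnsfun_approx measurableT mf.
have hf y : (h n y)%:E @[n --> \oo] --> f y by exact: cvg_nnsfun_approx.
have hnd y : {homo (fun n => (h n y)%:E) : a b / (a <= b)%N >-> a <= b}.
  by move=> a b ab; rewrite lee_fin; exact/lefP/nd_nnsfun_approx.
have mphiA A : measurable A -> measurable (phi @^-1` A).
  by move=> mA; rewrite -[_ @^-1` _]setTI; exact: mphi.
have mhphi n : measurable_fun setT (fun x => (h n (phi x))%:E).
  by apply/measurable_EFinP; apply: measurableT_comp.
have -> : \int[nu]_(y in D) f y = limn (fun n => \int[nu]_(y in D) (h n y)%:E).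
  rewrite -monotone_convergence//.
  - by apply: eq_integral => y _; apply/esym/cvg_lim.
  - by move=> n; apply/measurable_EFinP; apply: measurable_funTS.
  - by move=> n y _; rewrite lee_fin.
have -> : \int[m]_x (f (phi x) * g x) =
    limn (fun n => \int[m]_x ((h n (phi x))%:E * g x)).
  rewrite -monotone_convergence//.
  - apply: eq_integral => x _; apply/esym/cvg_lim => //.
    have := hf (phi x); case: (g x) (g0 x) => [r r0 hr|_ hr|//].
      exact: cvgeZr.
    (* At infinite density the products are 0 for all [n] if [f (phi x) = 0], the approximations
       lying below [f]; otherwise they are eventually infinite, as is the limit. *)
    have [fx0|fx0] := eqVneq (f (phi x)) 0.
      rewrite fx0 mul0e; apply: cvg_near_cst; apply: nearW => n; apply/eqP.
      have : (h n (phi x))%:E <= 0.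
        by rewrite -fx0 nnsfun_approxE; exact: le_approx.
      by rewrite lee_fin => h0; rewrite (_ : h n _ = 0%R) ?mul0e//; apply/eqP; rewrite eq_le h0 fun_ge0.
    have {}fx0 : 0 < f (phi x) by rewrite lt0e fx0 f0.
    rewrite gt0_muley//.
    have [N _ hN] : \forall n \near \oo, 0 < (h n (phi x))%:E.
      exact: (hr _ (open_ereal_gt' fx0)).
    apply: cvg_near_cst; exists N => // n /= /hN h0; apply/eqP.
    by rewrite gt0_muley.
  - by move=> n; exact: emeasurable_funM.
  - by move=> n x _; rewrite mule_ge0// lee_fin.
  - by move=> x _ a b ab; rewrite lee_wpmul2r//; exact: hnd.
congr (limn _); apply/funext => n.
have hE y : (h n y)%:E = \sum_(r \in range (h n)) (r * \1_(h n @^-1` [set r]) y)%:E.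
  by rewrite [in LHS]fimfunE -fsumEFin.
under eq_integral do rewrite hE.
have mind r : measurable_fun setT (fun y => (r * \1_(h n @^-1` [set r]) y)%:E).
  by apply/measurable_EFinP; apply: measurable_funM.
rewrite ge0_integral_fsum//; last 2 first.
- by move=> r; exact: measurable_funTS.
- by move=> r y Dy; exact: nnfun_muleindic_ge0.
under [RHS]eq_integral.
  move=> x _; rewrite hE ge0_mule_fsuml; last by move=> r; exact: nnfun_muleindic_ge0.
  over.
rewrite ge0_integral_fsum//; last 2 first.
- move=> r; apply: emeasurable_funM => //.
  exact: (measurableT_comp (mind r)).
- by move=> r x _; rewrite mule_ge0// nnfun_muleindic_ge0.
apply: eq_fsbigr => r; rewrite inE => -[y0 _ <-].
have r0 : 0 <= (h n y0)%:E by rewrite lee_fin.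
have mpre : measurable (h n @^-1` [set h n y0]) by [].
under eq_integral do rewrite EFinM.
rewrite ge0_integralZl//; last first.
- by apply/measurable_EFinP; apply: measurable_funTS.
rewrite integral_indic// nuE//.
under [RHS]eq_integral do rewrite EFinM -muleA.
rewrite ge0_integralZl//; last first.
- by move=> y _; rewrite mule_ge0// lee_fin.
- apply: emeasurable_funM => //; apply/measurable_EFinP.
  rewrite (_ : (fun x => _) = \1_(phi @^-1` (h n @^-1` [set h n y0])))//.
  exact/measurable_indic/mphiA.
congr (_ * _); rewrite integral_mkcond; apply: eq_integral => x _.
rewrite patchE indicE; have [xA|xA] := pselect (h n (phi x) = h n y0).
  by rewrite !mem_set// mul1e.
by rewrite !memNset// mul0e.
Qed.

End integral_density.

(** For [x < 0] the interval is empty and the value is 0, not a signed integral. *)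
Definition prim {R : realType} (f : R -> R) (x : R) : R :=
  \int[@lebesgue_measure R]_(y in `[0, x]) f y.

Section primitive.
Context {R : realType}.
Local Notation mu := (@lebesgue_measure R).

Lemma ae_derive1_integral (f : R -> R) : mu.-integrable setT (EFin \o f) ->
  {ae mu, forall z, 0 < z ->
    derivable (prim f) z 1 /\
    derive1 (prim f) z = f z}.
Proof.
move=> intf; have := @FTC1 R f (BLeft 0).
have h1 y : mu.-integrable [set` Interval (BLeft 0) (BRight y)] (EFin \o f).
  exact: integrableS intf.
have h2 : locally_integrable [set: R] f.
  by apply: open_integrable_locally => //; exact: openT.
move=> /(_ h1 h2) /=; apply: ae_mono => z h z0; apply: h.
by rewrite lte_fin.
Qed.

(** If [x] differs from [z], monotonicity makes [phi] constant between them, so difference quotients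
    at [z] taken towards [x] vanish, against a nonzero derivative. *)
Lemma derive1_neq0_level (phi : R -> R) x z : nondecreasing_fun phi ->
  derivable phi z 1 -> derive1 phi z != 0 -> phi x = phi z -> x = z.
Proof.
move=> nd dz d0 xz; apply/eqP; apply: contraNT d0 => xz'.
have [l dl] := (cvg_ex _).1 dz.
have -> : derive1 phi z = l by rewrite derive1E; apply/cvg_lim.
apply: contrapT => /negP l0.
have [e /= e0 he] := cvgr_neq0 _ dl l0.
(* The increment must stay in the neighbourhood where quotients are nonzero and must not go beyond
   [x]; its sign directs it from [z] to [x]. *)
pose k := Num.min (e / 2) `|x - z|.
have k0 : 0 < k by rewrite lt_min divr_gt0//= normr_gt0 subr_eq0.
pose h := Num.sg (x - z) * k.
have hk : `|h| = k.
  by rewrite normrM normr_sg subr_eq0 xz' mul1r gtr0_norm.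
have h0 : h != 0 by rewrite -normr_gt0 hk.
have hb : ball_ Num.norm (0 : R) e h.
  rewrite /ball_/= sub0r normrN hk gt_min; apply/orP; left.
  by rewrite gtr_pMr// invf_lt1// ltr1n.
have := he h hb h0; rewrite /=.
suff -> : phi (h%:A + z) = phi z by rewrite subrr scaler0 eqxx.
rewrite [h%:A]mulr1 /h.
have kxz : k <= `|x - z| by rewrite ge_min lexx orbT.
have [lt|gt|eq] := ltgtP x z; last by rewrite eq eqxx in xz'.
- have xz0 : x - z < 0 by rewrite subr_lt0.
  rewrite ltr0_sg// mulN1r; rewrite ltr0_norm// in kxz.
  by apply/le_anti/andP; split; [|rewrite -xz]; apply: nd; lra.
- have xz0 : 0 < x - z by rewrite subr_gt0.
  rewrite gtr0_sg// mul1r; rewrite gtr0_norm// in kxz.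
  by apply/le_anti/andP; split; [rewrite -xz|]; apply: nd; lra.
Qed.

End primitive.

Section monotone_change_of_variables.
Context {R : realType}.
Local Notation mu := (@lebesgue_measure R).
Variable P : R -> R.
Hypothesis mP : measurable_fun setT P.
Hypothesis P0 : forall x, 0 <= P x.
Hypothesis Pout : forall x, x \notin `[0, 1] -> P x = 0.
Hypothesis P1 : (\int[mu]_x (P x)%:E = 1)%E.

Let phi := prim P.

Let intP : mu.-integrable setT (EFin \o P).
Proof.
apply/integrableP; split; first exact/measurable_EFinP.
under eq_integral do rewrite /= ger0_norm//.
by rewrite P1 ltry.
Qed.

Let intPS (A : set R) : measurable A -> mu.-integrable A (EFin \o P).
Proof. by move=> mA; apply: integrableS intP. Qed.

Let phiE x : (phi x)%:E = (\int[mu]_(y in `]-oo, x]) (P y)%:E)%E.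
Proof.
rewrite /phi /prim /Rintegral fineK; last exact: integrable_fin_num (intPS _ _).
apply: ae_restrict_eq_integral; apply: ae_all => y; rewrite !patchE.
have [y01|y01] := boolP (y \in `[0, 1]); last by rewrite Pout// !if_same.
congr (if _ then _ else _); apply/idP/idP; rewrite !inE/= !in_itv/=.
  by case/andP.
by move=> ->; rewrite (itvP y01).
Qed.

Lemma prim_nd : nondecreasing_fun phi.
Proof.
move=> x y xy; rewrite -lee_fin !phiE; apply: ge0_subset_integral => //.
- by apply/measurable_EFinP; exact: measurable_funTS.
- by move=> z _; rewrite lee_fin.
- by apply: subset_itvl; rewrite bnd_simp.
Qed.

Lemma prim0 : phi 0 = 0.
Proof. by rewrite /phi /prim set_itv1 Rintegral_set1. Qed.

Lemma prim1 x : 1 <= x -> phi x = 1.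
Proof.
move=> x1; apply: EFin_inj; rewrite phiE -P1.
apply: ae_restrict_eq_integral; apply: ae_all => y; rewrite !patchE.
have [y01|y01] := boolP (y \in `[0, 1]); last by rewrite Pout// !if_same.
by rewrite !mem_set//= in_itv/= (le_trans _ x1)// (itvP y01).
Qed.

Lemma prim_le1 x : phi x <= 1.
Proof.
rewrite -(prim1 (Num.max x 1)) ?le_max ?lexx ?orbT//.
by apply: prim_nd; rewrite le_max lexx.
Qed.

Lemma prim_ge0 x : 0 <= phi x.
Proof. by apply: Rintegral_ge0. Qed.

Lemma prim_itv x : phi x \in `[0, 1].
Proof. by rewrite in_itv/= prim_ge0 prim_le1. Qed.

Lemma measurable_prim : measurable_fun setT phi.
Proof. exact: nondecreasing_measurable prim_nd. Qed.

(** Starting the integral at -1 changes nothing, as [P] vanishes there, and makes the end points 0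
    and 1 interior to the interval of continuity. *)
Lemma prim_continuous x : -1 < x < 2 -> {for x, continuous phi}.
Proof.
move=> /andP[x1 x2].
have phi' y : phi y = \int[mu]_(z in `[-1, y]) P z.
  congr fine; apply: ae_restrict_eq_integral; apply: ae_all => z; rewrite !patchE.
  have [z01|z01] := boolP (z \in `[0, 1]); last by rewrite Pout// !if_same.
  congr (if _ then _ else _); apply/idP/idP; rewrite !inE/= !in_itv/=.
    by move=> /andP[z0 ->]; rewrite (le_trans _ z0)//; lra.
  by move=> /andP[_ ->]; rewrite (itvP z01).
have -> : phi = (fun y => \int[mu]_(z in `[-1, y]) P z) by apply/funext.
have := @parameterized_integral_continuous R (-1) 2 P.
have -> : (-1 : R) <= 2 by lra.
move=> /(_ isT (intPS _ (measurable_itv _))).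
have h : (-1 : R) < 2 by lra.
move/(continuous_within_itvP _ h) => [+ _ _]; apply.
by rewrite in_itv/= x1.
Qed.

(** Generalized inverse: for [y] in the unit interval it selects the right end of the level set of
    [y]. Taking the largest point is what yields the Galois relation [prim_le_inv], by which
    preimages of rays are rays. *)
Definition prim_inv y : R := sup [set x | x \in `[0, 1] /\ phi x <= y].

Let psi := prim_inv.

Let psi_has_sup y : 0 <= y -> has_sup [set x | x \in `[0, 1] /\ phi x <= y].
Proof.
move=> y0; split.
  by exists 0; split; [rewrite in_itv/= lexx ler01|rewrite prim0].
by exists 1 => x -[]; rewrite in_itv/= => /andP[].
Qed.

Lemma prim_inv_itv y : 0 <= y -> psi y \in `[0, 1].
Proof.
move=> y0; rewrite in_itv/=; apply/andP; split.
  apply: sup_upper_bound (psi_has_sup _ y0) _ _.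
  by split; [rewrite in_itv/= lexx ler01|rewrite prim0].
apply: ge_sup; first exact: (psi_has_sup _ y0).1.
by move=> x -[]; rewrite in_itv/= => /andP[].
Qed.

Let psi_ge y x : 0 <= y -> x \in `[0, 1] -> phi x <= y -> x <= psi y.
Proof. by move=> y0 x01 xy; apply: sup_upper_bound (psi_has_sup _ y0) _ _. Qed.

(** A value above [y] at the supremum would persist nearby by continuity, against points of the
    sublevel set approaching it. Conversely the intermediate value theorem gives a point of level
    [y], which lies below the supremum. *)
Lemma prim_invK y : y \in `[0, 1] -> phi (psi y) = y.
Proof.
rewrite in_itv/= => /andP[y0 y1]; apply/eqP; rewrite eq_le; apply/andP; split.
  rewrite leNgt; apply/negP => yphi.
  have := prim_inv_itv _ y0; rewrite in_itv/= => /andP[s0 s1].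
  have : {for psi y, continuous phi} by apply: prim_continuous; lra.
  move=> /cvgr_gt/(_ _ yphi)[e /= e0 he].
  have [x [x01 xy] sx] := sup_adherent e0 (psi_has_sup _ y0).
  have xs : x <= psi y by exact: psi_ge.
  have : y < phi x.
    by apply: he; rewrite /ball/= ger0_norm ?subr_ge0//; rewrite ltrBlDr -ltrBlDl.
  by rewrite ltNge xy.
have [||c] := @IVT R phi 0 1 y ler01.
- apply: continuous_in_subspaceT => x; rewrite inE/= in_itv/= => /andP[x0 x1].
  by apply: prim_continuous; lra.
- by rewrite prim0 prim1// minEle maxEle ler01 y0.
by move=> c01 <-; apply: prim_nd; apply: psi_ge => //; exact: prim_ge0.
Qed.

Lemma prim_le_inv x y : y \in `[0, 1] -> x \in `[0, 1] ->
  (phi x <= y) = (x <= psi y).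
Proof.
move=> y01 x01; have y0 : 0 <= y by rewrite (itvP y01).
apply/idP/idP => [|xy]; first exact: psi_ge.
by rewrite -[leRHS](prim_invK _ y01); exact: prim_nd.
Qed.

Lemma nondecreasing_prim_inv : nondecreasing_fun psi.
Proof.
move=> x y xy; have [x0|x0] := leP 0 x.
  apply: ge_sup; first exact: (psi_has_sup _ x0).1.
  by move=> z [z01 zx]; apply: psi_ge; rewrite ?(le_trans _ xy).
(* For negative arguments the sublevel set is empty and its supremum is 0 by convention, which is
   compatible with monotonicity. *)
have -> : psi x = 0.
  rewrite /psi /prim_inv (_ : [set _ | _] = set0) ?sup0//.
  apply/seteqP; split => // z [_]; rewrite leNgt => /negP; apply.
  exact: lt_le_trans (prim_ge0 _).
have [y0|y0] := leP 0 y; first by rewrite (itvP (prim_inv_itv _ y0)).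
rewrite /psi /prim_inv (_ : [set _ | _] = set0) ?sup0//.
apply/seteqP; split => // z [_]; rewrite leNgt => /negP; apply.
exact: lt_le_trans (prim_ge0 _).
Qed.

Lemma measurable_prim_inv : measurable_fun setT psi.
Proof. exact: nondecreasing_measurable nondecreasing_prim_inv. Qed.

Let pre_le y : y \in `[0, 1[ -> phi @^-1` `]y, +oo[ = `]psi y, +oo[%classic.
Proof.
move=> y01; have y01' : y \in `[0, 1] by rewrite in_itv/= !(itvP y01).
have y0 : 0 <= y by rewrite (itvP y01).
apply/seteqP; split => x /=; rewrite !in_itv/= !andbT => h.
  rewrite ltNge; apply/negP => /prim_nd; rewrite -/phi.
  by rewrite (prim_invK _ y01') leNgt h.
have := prim_inv_itv _ y0; rewrite in_itv/= => /andP[s0 s1].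
have [x1|x1] := leP x 1; last by rewrite (prim1 _ (ltW x1)) (itvP y01).
rewrite ltNge (prim_le_inv _ _ y01') -?ltNge// in_itv/= x1 andbT.
by rewrite (le_trans s0)// ltW.
Qed.

Let nu (A : set (measurableTypeR R)) : \bar R := (\int[mu]_(x in phi @^-1` A) (P x)%:E)%E.

Let pre_measurable A : measurable A -> measurable (phi @^-1` A).
Proof. by move=> mA; rewrite -[_ @^-1` _]setTI; exact: measurable_prim. Qed.

Let nu_semi_sigma_additive : semi_sigma_additive nu.
Proof.
move=> /= F mF tF mUF; rewrite /nu preimage_bigcup ge0_integral_bigcup//.
- apply: is_cvg_ereal_nneg_natsum_cond => n _ _.
  by apply: integral_ge0 => x _; rewrite lee_fin.
- by move=> n; exact: (pre_measurable _ (mF n)).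
- by apply/measurable_EFinP; exact: measurable_funTS.
- by move=> x _; rewrite lee_fin.
- apply/trivIsetP => i j _ _ ij; rewrite -preimage_setI.
  by move/trivIsetP : tF => /(_ _ _ _ _ ij) ->//; rewrite preimage_set0.
Qed.

Let nu0 : nu set0 = 0%E.
Proof. by rewrite /nu preimage_set0 integral_set0. Qed.

Let nu_ge0 A : (0 <= nu A)%E.
Proof. by apply: integral_ge0 => x _; rewrite lee_fin. Qed.

Let numeas : {measure set (measurableTypeR R) -> \bar R} :=
  HB.pack_for {measure set (measurableTypeR R) -> \bar R} nu
   (isMeasure.Build _ _ _ nu nu0 nu_ge0 nu_semi_sigma_additive).

(** Both sides are measures in [A], so it is enough to compare them on the rays to the right of [y],
    which generate the Borel sets and are stable under intersection. For [y] in the unit interval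
    both give [1 - y]. *)
Lemma lebesgue_measure_prim (A : set R) : measurable A ->
  mu (A `&` `[0, 1]) = (\int[mu]_(x in phi @^-1` A) (P x)%:E)%E.
Proof.
move=> mA; rewrite -/(nu A).
have m01 : measurable (`[0, 1]%classic : set R) by [].
apply: (@measure_unique _ R (measurableTypeR R) (@RGenOInfty.G R) (fun n => `]- n%:R, +oo[%classic)
  _ _ _ _ (mrestr mu m01) numeas) => //=.
- exact: RGenOInfty.measurableE.
- move=> _ _ [x ->] [y ->]; exists (Num.max x y).
  by apply/seteqP; split => z /=; rewrite !in_itv/= !andbT gt_max;
    [move=> [-> ->]|move=> /andP[]].
- by move=> n; eexists.
- apply/seteqP; split => // x _; exists (Num.truncn `|x|).+1 => //=.
  rewrite in_itv/= andbT ltrNl.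
  by rewrite (le_lt_trans _ (truncnS_gt _))// -normrN ler_norm.
- move=> _ [y ->]; rewrite /mrestr/=.
  have [y0|y0] := ltP y 0.
    rewrite (_ : _ `&` _ = `[0, 1]%classic); last first.
      apply/seteqP; split => x /= ; first by case.
      by move=> x01; split => //; rewrite in_itv/= (lt_le_trans y0)// (itvP x01).
    rewrite lebesgue_measure_itv/= lte_fin ltr01 -EFinB subr0.
    rewrite /nu (_ : _ @^-1` _ = setT) ?P1//.
    by apply/seteqP; split => x //= _; rewrite in_itv/= (lt_le_trans y0)// prim_ge0.
  have [y1|y1] := leP 1 y.
    rewrite (_ : _ `&` _ = set0); last first.
      apply/seteqP; split => x //= [].
      by rewrite !in_itv/= andbT => yx /andP[_ x1]; lra.
    rewrite measure0 /nu (_ : _ @^-1` _ = set0) ?integral_set0//.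
    apply/seteqP; split => x //=.
    by rewrite in_itv/= ltNge (le_trans (prim_le1 _) y1).
  have y01 : y \in `[0, 1[ by rewrite in_itv/= y0.
  have y01' : y \in `[0, 1] by rewrite in_itv/= y0 ltW.
  rewrite /nu (pre_le _ y01) (_ : _ `&` _ = `]y, 1]%classic); last first.
    apply/seteqP; split => x /=; rewrite !in_itv/= ?andbT.
      by move=> [-> /andP[]].
    by move=> /andP[yx ->]; rewrite yx (le_trans y0)// ltW.
  rewrite lebesgue_measure_itv/= lte_fin y1 -EFinB.
  set X := (X in _ = X).
  have Xfin : X \is a fin_num.
    by apply: integrable_fin_num => //; exact: intPS.
  (* The total mass 1 is split at [psi y]; the left part has mass [phi (psi y) = y]. *)
  have : (1 = y%:E + X)%E.
    rewrite -P1 -{1}(prim_invK _ y01') phiE -ge0_integral_setU//=.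
    - by rewrite -itv_bndbnd_setU// set_itvNyy.
    - by apply/measurable_EFinP; exact: measurable_funTS.
    - by move=> z _; rewrite lee_fin.
    - by apply/disj_setPLR => z /=; rewrite !in_itv/= andbT => zy; apply/negP; rewrite -leNgt.
  move=> E; rewrite -(fineK Xfin); congr EFin.
  have [E1] : (1%:E = (y + fine X)%:E)%E by rewrite EFinD fineK.
  by rewrite E1 addrAC subrr add0r.
- move=> k; rewrite /mrestr.
  by rewrite (@le_lt_trans _ _ (mu `[0, 1]%classic)) ?le_measure ?inE//=;
    rewrite ?lebesgue_measure_itv/= ?lte_fin ?ltr01 -?EFinB ?ltry//; exact: measurableI.
Qed.

Lemma ge0_integral_prim (w : R -> \bar R) : measurable_fun setT w ->
  (forall y, 0 <= w y)%E ->
  (\int[mu]_(y in `[0%R, 1%R]) w y = \int[mu]_x (w (phi x) * (P x)%:E))%E.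
Proof.
move=> mw w0; apply: ge0_integral_image_density => //.
- exact: measurable_prim.
- exact/measurable_EFinP.
- by move=> A mA; exact: lebesgue_measure_prim.
Qed.

Lemma integral_prim (w : R -> R) : measurable_fun setT w ->
  (\int[mu]_(y in `[0%R, 1%R]) (w y)%:E = \int[mu]_x (w (phi x) * P x)%:E)%E.
Proof.
move=> mw; have mw' : measurable_fun setT (EFin \o w) by exact/measurable_EFinP.
rewrite integralE [RHS]integralE !ge0_integral_prim//.
- congr (_ - _)%E; apply: eq_integral => x _; rewrite ?funeposE ?funenegE /=.
    by rewrite -!EFin_max -EFinM maxr_pMl// mul0r.
  by rewrite -!EFin_max -EFinM maxr_pMl// mul0r mulNr.
- exact: measurable_funeneg.
- exact: measurable_funepos.
Qed.

Lemma integrable_prim (w : R -> R) : measurable_fun setT w ->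
  mu.-integrable setT (fun x => (w (phi x) * P x)%:E) ->
  mu.-integrable `[0, 1] (EFin \o w).
Proof.
move=> mw /integrableP[_ wP]; apply/integrableP; split.
  by apply/measurable_EFinP; exact: measurable_funTS.
rewrite ge0_integral_prim//=.
  by move: wP; congr (_ < _)%E; apply: eq_integral => x _ /=; rewrite normrM (ger0_norm (P0 x)).
by apply/measurable_EFinP; exact: measurableT_comp.
Qed.

(** The preimage of a null set can have positive measure, since [phi] may collapse sets. By change
    of variables, however, [P] has integral 0 on that preimage, so [P] vanishes almost everywhere on
    it. *)
Lemma ae_prim (Q : R -> Prop) : aeS Q ->
  {ae mu, forall x, P x != 0 -> Q (phi x)}.
Proof.
move=> [N [mN N0 QN]].
have : (\int[mu]_(x in setT) `|(\1_N (phi x) * P x)%:E| = 0)%E.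
  transitivity (\int[mu]_(y in `[0%R, 1%R]) (\1_N y)%:E)%E.
    rewrite integral_prim; last exact: measurable_indic.
    by apply: eq_integral => x _; rewrite gee0_abs// lee_fin mulr_ge0.
  rewrite integral_indic//; apply/eqP; rewrite -measure_le0 -N0.
  by apply: le_measure; rewrite ?inE//; exact: measurableI.
move/ae_eq_integral_abs => h.
apply: ae_mono (h measurableT _) => [x /(_ Logic.I)|]; last first.
  apply/measurable_EFinP; apply: measurable_funM => //.
  exact: (measurableT_comp (measurable_indic mN) measurable_prim).
move=> [/eqP] + Px; rewrite mulf_eq0 (negbTE Px) orbF indicE.
have [|Nx _] := boolP (phi x \in N); first by rewrite oner_eq0.
apply: contrapT => nQ; move: Nx; rewrite mem_set//; apply: QN => /= h0.
by apply: nQ; apply: h0; exact: prim_itv.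
Qed.

Lemma ae_prim_level :
  {ae mu, forall z, P z != 0 -> derivable phi z 1 /\ derive1 phi z = P z /\
                   forall x, phi x = phi z -> x = z}.
Proof.
apply: ae_mono2 (ae_derive1_integral _ intP) (ae_neq 0) => z h /eqP z0 Pz.
have z01 : z \in `[0, 1] by apply: contraNT Pz => /Pout ->.
have [|dz Pz'] := h; first by rewrite lt0r z0 (itvP z01).
split => //; split => // x; apply: derive1_neq0_level => //; first exact: prim_nd.
by rewrite Pz'.
Qed.

(** The formula on the whole interval is applied to [w] cut off at [phi x]. *)
Lemma Rintegral_prim (w : R -> R) x : measurable_fun setT w ->  x \in `[0, 1] ->
  \int[mu]_(y in `[0, phi x]) w y = \int[mu]_(y in `[0, x]) (w (phi y) * P y).
Proof.
move=> mw x01; congr fine.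
have mphix : measurable (`[0, phi x]%classic : set R) by [].
transitivity (\int[mu]_(y in `[0%R, 1%R]) (w y * \1_`[0%R, phi x] y)%:E)%E.
  apply: ae_restrict_eq_integral; apply: ae_all => y; rewrite !patchE indicE.
  have [|yx] := boolP (y \in `[0, phi x]%classic).
    rewrite inE/= in_itv/= => /andP[y0 yx].
    by rewrite mulr1 mem_set//= in_itv/= y0 (le_trans yx)// prim_le1.
  by rewrite mulr0 if_same.
rewrite integral_prim; last by apply: measurable_funM => //; exact: measurable_indic.
rewrite [RHS]integral_mkcond; apply: ae_eq_integral_nonmeas.
(* The cuts [phi z <= phi x] and [z <= x] differ only for [z > x] on the level set of [x]. There
   [P z] must be 0, since a point with [P z != 0] is alone on its level set, and the integrand
   vanishes. *)
apply: ae_mono ae_prim_level => z h _; rewrite patchE indicE.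
have [Pz|/h[_ [_ inj]]] := eqVneq (P z) 0; first by rewrite Pz !mulr0 if_same.
have [zx|zx] := leP z x.
  have [z0|z0] := leP 0 z; last first.
    by rewrite Pout ?in_itv/= ?mulr0 ?if_same// leNgt z0.
  rewrite !mem_set ?mulr1//= in_itv/= ?prim_ge0 ?z0//=.
  exact: prim_nd.
rewrite (memNset (_ : ~ `[0, x]%classic z)); last by rewrite /= in_itv/= (leNgt z) zx andbF.
rewrite memNset ?mulr0 ?mul0r//= in_itv/=.
move=> /andP[_ zx']; have := prim_nd _ _ (ltW zx); rewrite -/phi => xz.
have /inj xz' : phi x = phi z by apply/le_anti; rewrite xz.
by rewrite xz' ltxx in zx.
Qed.

End monotone_change_of_variables.

(** * Weak derivatives *)

Section L2_functions.
Context {R : realType}.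
Local Notation mu := (@lebesgue_measure R).
Implicit Types f g : R -> R.

(** Borel on the whole line and zero off the circle: integrals over the line and over the unit
    interval then coincide. *)
Definition L2S g : Prop :=
  [/\ measurable_fun setT g, forall x, x \notin `[0, 1] -> g x = 0
    & mu.-integrable setT (fun x => (g x ^+ 2)%:E)].

Lemma H0_L2S f : H0 f -> exists2 g, L2S g & aeS (fun x => f x = g x).
Proof.
move=> [g [mg ig fg]]; exists (g \_ `[0, 1]).
  split.
  - by apply/(measurable_restrictT g) => //; exact: measurable_itv.
  - move=> x /negP x01; rewrite patchE; case: ifPn => //.
    by rewrite inE.
  - have : mu.-integrable setT ((fun x => (g x ^+ 2)%:E) \_ `[0, 1]).
      by apply: (integrable_mkcond _ _).1 => //; exact: measurable_itv.
    apply: eq_integrable => // x _; rewrite /= !patchE.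
    by case: ifP => //; rewrite expr0n.
by apply: ae_mono fg => x fgx x01; rewrite patchE mem_set//; exact: fgx.
Qed.

Lemma L2S_H0 g : L2S g -> H0 g.
Proof.
move=> [mg g0 ig]; exists g; split.
- exact: measurable_funTS.
- exact: integrableS ig.
- exact: ae_all.
Qed.

Lemma integrable_indic01 : mu.-integrable setT (EFin \o (\1_`[0, 1] : R -> R)).
Proof. exact: integrable_indic_itv. Qed.

Lemma L2S_integrable g : L2S g -> mu.-integrable setT (EFin \o g).
Proof.
move=> [mg g0 ig].
(* The bound is |g| <= 1 + g^2 on an interval of finite measure. *)
apply: (@le_integrable _ _ _ mu setT measurableT _
  (fun x => (\1_`[0, 1] x)%:E + (g x ^+ 2)%:E)%E).
- exact/measurable_EFinP.
- move=> x _; rewrite /= lee_fin [leRHS]ger0_norm; last first.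
    by rewrite addr_ge0 ?sqr_ge0.
  have [x01|x01] := boolP (x \in `[0, 1]); last by rewrite g0// normr0 addr_ge0 ?sqr_ge0.
  rewrite indicE mem_set//= -(real_normK (num_real (g x))).
  by have := normr_ge0 (g x); nra.
- exact: integrableD integrable_indic01 ig.
Qed.

Lemma prim_ext f g x : aeS (fun x => f x = g x) -> x <= 1 -> prim f x = prim g x.
Proof.
move=> fg x1; apply: ae_eq_Rintegral_nonmeas; apply: ae_mono fg => y fgy.
by rewrite /= in_itv/= => /andP[y0 yx]; apply: fgy; rewrite in_itv/= y0 (le_trans yx).
Qed.

End L2_functions.

Section weak_derivatives.
Context {R : realType}.
Local Notation mu := (@lebesgue_measure R).

Lemma C1S_cst (c : R) : C1S (fun=> c).
Proof.
split => // x.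
have -> : derive1 (fun=> c : R) = (fun=> 0) by apply/funext => y; rewrite derive1_cst.
exact: cvg_cst.
Qed.

Lemma C1S_continuous (psi : R -> R) : C1S psi -> continuous psi.
Proof.
by move=> [_ dpsi _] x; exact/differentiable_continuous/derivable1_diffP.
Qed.

Lemma integrable01M_continuous (w psi : R -> R) : continuous psi ->
  mu.-integrable `[0, 1] (EFin \o w) ->
  mu.-integrable `[0, 1] (EFin \o (fun x => w x * psi x)).
Proof.
move=> cpsi iw; have [|c c01 hc] := @EVT_max R (fun x => `|psi x|) 0 1 ler01.
  by apply: continuous_subspaceT => x; apply: cvg_norm; exact: cpsi.
have /integrableP[/measurable_EFinP mw _] := iw.
apply: (@le_integrable _ _ _ mu _ _ _ (fun x => (w x)%:E * (psi c)%:E)%E) => //.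
- apply/measurable_EFinP/measurable_funM => //.
  by apply: measurable_funTS; exact: continuous_measurable_fun.
- by move=> x x01 /=; rewrite lee_fin !normrM ler_wpM2l// hc.
- exact: integrableZr.
Qed.

Section antiderivative.
Variables (w psi : R -> R).
Hypothesis mw : measurable_fun setT w.
Hypothesis w0 : forall x, x \notin `[0, 1] -> w x = 0.
Hypothesis iw : mu.-integrable setT (EFin \o w).
Hypothesis C1psi : C1S psi.

Let D := derive1 psi.

Let cD : continuous D. Proof. by case: C1psi. Qed.

Let mD : measurable_fun setT D.
Proof. exact: continuous_measurable_fun. Qed.

Let Dbound : exists2 C, 0 <= C & forall x, x \in `[0, 1] -> `|D x| <= C.
Proof.
have [|c c01 hc] := @EVT_max R (fun x => `|D x|) 0 1 ler01.
  by apply: continuous_subspaceT => x; apply: cvg_norm; exact: cD.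
by exists `|D c| => // x; exact: hc.
Qed.

Let FTC z : z \in `[0, 1] -> \int[mu]_(y in `[z, 1]) D y = psi 1 - psi z.
Proof.
rewrite in_itv/= => /andP[z0 z1].
have [->|zn1] := eqVneq z 1; first by rewrite set_itv1 Rintegral_set1 subrr.
have {zn1}z1 : z < 1 by rewrite lt_neqAle zn1.
have [_ dpsi _] := C1psi.
have cpsi : continuous psi.
  by move=> x; exact/differentiable_continuous/derivable1_diffP.
have LR : derivable_oo_LRcontinuous psi z 1.
  split; first by move=> x _; exact: dpsi.
  + exact/cvg_at_right_filter/cpsi.
  + exact/cvg_at_left_filter/cpsi.
have cD01 : {within `[z, 1], continuous D} by apply: continuous_subspaceT; exact: cD.
by rewrite /Rintegral (continuous_FTC2 z1 cD01 LR).
Qed.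

(** Kernel of an integration by parts: [K (y, z)] is [w z * D y] cut to [z <= y]. Integrating first
    in [z] produces [prim w y * D y], first in [y] it produces [w z * (psi 1 - psi z)], and Fubini
    equates the two. *)
Let K (p : R * R) : R :=
  w p.2 * (D p.1 * \1_`[0, 1] p.1) * \1_`[0, +oo[ (p.1 - p.2).

Let mK : measurable_fun setT K.
Proof.
apply: measurable_funM; first apply: measurable_funM.
- exact: (measurableT_comp mw measurable_snd).
- apply: measurable_funM; first exact: (measurableT_comp mD measurable_fst).
  have mi : measurable_fun setT (\1_(`[0, 1]%classic) : R -> R).
    by apply: measurable_indic; exact: measurable_itv.
  exact: (measurableT_comp mi measurable_fst).
- have mi : measurable_fun setT (\1_(`[0, +oo[%classic) : R -> R).
    by apply: measurable_indic; exact: measurable_itv.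
  exact: (measurableT_comp mi (measurable_funB measurable_fst measurable_snd)).
Qed.

Let iK : (mu \x mu)%E.-integrable setT (EFin \o K).
Proof.
have [C C0 hC] := Dbound.
apply/integrable21ltyP; first exact/measurable_EFinP.
have /integrableP[_ iw'] := iw.
apply: (@le_lt_trans _ _ (\int[mu]_z (C%:E * `|(w z)%:E|))%E); last first.
  rewrite ge0_integralZl//; last by apply: measurableT_comp => //; exact/measurable_EFinP.
  by rewrite lte_mul_pinfty// ?lee_fin.
apply: ge0_le_integral => //.
- by move=> z _; apply: integral_ge0.
- have mF : measurable_fun setT (fun p => `|(K p)%:E|%E).
    by apply: measurableT_comp => //; exact/measurable_EFinP.
  exact: (@measurable_fun_fubini_tonelli_G _ _ _ _ R mu _ mF (fun=> abse_ge0 _)).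
- apply: emeasurable_funM; first exact: measurable_cst.
  by apply: measurableT_comp => //; exact/measurable_EFinP.
move=> z _.
apply: (@le_trans _ _ (\int[mu]_y (C%:E * `|(w z)%:E| * (\1_`[0%R, 1%R] y)%:E))%E).
  apply: ge0_le_integral => //.
  - apply: measurableT_comp => //; apply/measurable_EFinP.
    exact: (measurableT_comp mK (measurable_pair2 _)).
  - apply: emeasurable_funM => //; apply/measurable_EFinP; exact: measurable_indic.
  - move=> y _ /=; rewrite lee_fin !normrM mulrAC [C * _]mulrC -!mulrA.
    rewrite ler_wpM2l// !indicE.
    have [y01|y01] := boolP (y \in `[0, 1]%classic); last by rewrite normr0 !mulr0.
    rewrite normr1 !mulr1 mulrC -[leRHS]mulr1 ler_pM//.
      by apply: hC; move: y01; rewrite inE.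
    by case: (_ \in _); rewrite ?normr1 ?normr0.
rewrite ge0_integralZl//; last 2 first.
- by apply/measurable_EFinP; exact: measurable_indic.
- by rewrite mule_ge0// lee_fin.
have mu01 : mu (`[0, 1]%classic : set R) = 1%E.
  by rewrite lebesgue_measure_itv/= lte_fin ltr01 -EFinB subr0.
rewrite integral_indic// setIT.
by rewrite [X in (_ * X <= _)%E](_ : _ = 1%E) ?mule1//; exact: mu01.
Qed.

Let Kz y : (\int[mu]_z (K (y, z))%:E =
  ((fun y => (prim w y * D y)%:E) \_ `[0%R, 1%R]) y)%E.
Proof.
rewrite patchE; case: ifPn => y01; last first.
  by under eq_integral do rewrite /K/= !indicE (negbTE y01) !mulr0 mul0r; rewrite integral0.
have {}y01 : y \in `[0, 1] by move: y01; rewrite inE.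
have iwy : mu.-integrable `[0, y] (EFin \o w) by exact: integrableS iw.
rewrite EFinM /prim /Rintegral fineK; last exact: integrable_fin_num.
rewrite -integralZr//.
apply: ae_restrict_eq_integral; apply: ae_all => z.
rewrite patch_setT patchE /K/= !indicE (@mem_set _ _ y)// mulr1.
have [z01|z01] := boolP (z \in `[0, 1]); last by rewrite w0// !mul0r mul0e if_same.
rewrite !mem_setE !in_itv/= andbT subr_ge0 (itvP z01)/=.
by case: ifP => _; rewrite ?mulr1 ?mulr0 -?EFinM.
Qed.

Let Ky z : (\int[mu]_y (K (y, z))%:E =
  ((fun z => (w z * (psi 1 - psi z))%:E) \_ `[0%R, 1%R]) z)%E.
Proof.
rewrite patchE; case: ifPn => z01; last first.
  have {}z01 : z \notin `[0, 1] by apply: contraNN z01 => z01; rewrite inE.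
  by under eq_integral do rewrite /K/= (w0 z z01) !mul0r; rewrite integral0.
have {}z01 : z \in `[0, 1] by move: z01; rewrite inE.
have iD : mu.-integrable `[z, 1] (EFin \o D).
  apply: continuous_compact_integrable; first exact: segment_compact.
  by apply: continuous_subspaceT; exact: cD.
rewrite -(FTC _ z01) EFinM /Rintegral fineK; last exact: integrable_fin_num.
rewrite -integralZl//.
apply: ae_restrict_eq_integral; apply: ae_all => y.
rewrite patch_setT patchE /K/= !indicE.
rewrite !mem_setE !in_itv/= andbT subr_ge0.
have [zy|yz] := leP z y; last by rewrite mulr0.
rewrite (le_trans _ zy) ?(itvP z01)//=.
by case: ifP => _; rewrite ?mulr1 ?mulr0 -?EFinM.
Qed.

Lemma weak_derivative_prim_psi : \int[mu]_(x in `[0, 1]) w x = 0 ->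
  \int[mu]_(x in `[0, 1]) (prim w x * D x) = - \int[mu]_(x in `[0, 1]) (w x * psi x).
Proof.
move=> intw0.
have cpsi := C1S_continuous _ C1psi.
have iw1 : mu.-integrable `[0, 1] (EFin \o w) by exact: integrableS iw.
have iwpsi : mu.-integrable `[0, 1] (EFin \o (fun x => w x * psi x)).
  exact: integrable01M_continuous.
transitivity (\int[mu]_(z in `[0, 1]) (w z * (psi 1 - psi z))).
  congr fine; rewrite [LHS]integral_mkcond [RHS]integral_mkcond.
  under eq_integral do rewrite -Kz.
  by under [RHS]eq_integral do rewrite -Ky; exact: (Fubini iK).
under eq_Rintegral do rewrite mulrBr.
(* The boundary term is [psi 1] times the integral of [w], which is zero. *)
rewrite RintegralB//; last first.
  have := integrableZr _ (psi 1) iw1; apply => //.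
by rewrite RintegralZr// intw0 mul0r sub0r.
Qed.

End antiderivative.

End weak_derivatives.

(** * The fundamental lemma of the calculus of variations, with explicit periodic test functions *)

Section du_bois_reymond.
Context {R : realType}.
Local Notation mu := (@lebesgue_measure R).

(** A 1-periodic trigonometric polynomial in [y] vanishing at 0 and [x], positive on the arc between
    0 and [x] and negative on the arc between [x] and 1. *)
Let arc (x y : R) : R := cos (2 * pi * (y - x / 2)) - cos (pi * x).

Let arc_gt0 (x y : R) : 0 < y -> y < x -> x < 1 -> 0 < arc x y.
Proof.
move=> y0 yx x1; rewrite /arc subr_gt0 -(cos_norm (2 * pi * _)).
have p0 := @pi_gt0 R.
have lt : `|2 * pi * (y - x / 2)| < pi * x by rewrite ltr_norml; apply/andP; split; nra.
by rewrite ltr_cos// in_itv/=; apply/andP; split; rewrite ?normr_ge0//; nra.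
Qed.

Let arc_lt0 (x y : R) : 0 < x -> x < y -> y < 1 -> arc x y < 0.
Proof.
move=> x0 xy y1; rewrite /arc subr_lt0.
have p0 := @pi_gt0 R.
have h1 : 0 < pi * x by rewrite mulr_gt0.
have h2 : 0 < pi * (1 - y) by rewrite mulr_gt0// subr_gt0.
have h3 : 0 < pi * (y - x) by rewrite mulr_gt0// subr_gt0.
(* Cosine is compared on [0, pi], where it decreases; an angle beyond pi is first reflected to 2 pi
   minus itself. *)
have [lepi|gtpi] := leP (2 * pi * (y - x / 2)) pi.
  by rewrite ltr_cos ?in_itv/=; [lra|apply/andP; split; lra..].
rewrite -(cosN (2 * pi * _)) -cosD2pi.
by rewrite ltr_cos ?in_itv/=; [lra|apply/andP; split; lra..].
Qed.

(** C^1, periodic and bounded by pi / 2, these functions converge pointwise to pi / 2 times the sign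
    of [arc]. *)
Let step (x : R) (n : nat) (y : R) : R := atan (n%:R * arc x y).

Let darc (x y : R) : is_derive y 1 (arc x) (- sin (2 * pi * (y - x / 2)) * (2 * pi)).
Proof.
rewrite /arc.
apply: is_derive_eq.
by rewrite /GRing.scale/=; ring.
Qed.

Let dstep (x : R) n (y : R) : is_derive y 1 (step x n)
  ((1 + (n%:R * arc x y) ^+ 2)^-1 * (n%:R * (- sin (2 * pi * (y - x / 2)) * (2 * pi)))).
Proof.
rewrite /step.
have h := darc x y.
apply: is_derive_eq.
by rewrite /GRing.scale/=; ring.
Qed.

Let continuous_arc (x : R) : continuous (arc x).
Proof.
move=> y; apply/differentiable_continuous/derivable1_diffP.
exact: (@ex_derive _ _ _ _ _ _ _ (darc x y)).
Qed.

Let C1S_step (x : R) n : C1S (step x n).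
Proof.
split.
- move=> y; rewrite /step /arc.
  have -> : 2 * pi * (y + 1 - x / 2) = 2 * pi * (y - x / 2) + pi *+ 2 by ring.
  by rewrite cosD2pi.
- by move=> y; exact: (@ex_derive _ _ _ _ _ _ _ (dstep x n y)).
- have -> : derive1 (step x n) = (fun y => (1 + (n%:R * arc x y) ^+ 2)^-1 *
    (n%:R * (- sin (2 * pi * (y - x / 2)) * (2 * pi)))).
    apply/funext => y; rewrite derive1E.
    exact: (@derive_val _ _ _ _ _ _ _ (dstep x n y)).
  move=> y; apply: cvgM.
    apply: cvgV; first by rewrite gt_eqF// ltr_pwDl// sqr_ge0.
    apply: cvgD; first exact: cvg_cst.
    apply: (@continuous_comp _ _ _ (fun y => n%:R * arc x y) (fun z => z ^+ 2)).
      by apply: cvgM; [exact: cvg_cst|exact: continuous_arc].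
    exact: exprn_continuous.
  apply: cvgM; first exact: cvg_cst.
  apply: cvgM; last exact: cvg_cst.
  apply: cvgN; apply: (continuous_comp (f := fun y => 2 * pi * (y - x / 2))).
    apply: cvgM; first exact: cvg_cst.
    by apply: cvgB; [exact: cvg_id|exact: cvg_cst].
  exact: continuous_sin.
Qed.

Let step_cvg (x y : R) : step x n y @[n --> \oo] --> pi / 2 * Num.sg (arc x y).
Proof.
have pos (c : R) : 0 < c -> atan (n%:R * c) @[n --> \oo] --> pi / 2.
  move=> c0; have h : r * c @[r --> +oo] --> +oo by apply: gt0_cvgMly => //; exact: cvg_id.
  exact: (cvg_comp _ _ (cvg_comp _ _ (@cvgr_idn R) h) (@cvgy_atan R)).
rewrite /step; have [a0|a0|a0] := sgrP (arc x y).
- by under eq_fun do rewrite a0 mulr0 atan0; rewrite mulr0; exact: cvg_cst.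
- by rewrite mulr1; exact: pos.
- rewrite mulrN1; under eq_fun do rewrite -[arc x y]opprK mulrN atanN.
  by apply: cvgN; apply: pos; rewrite oppr_gt0.
Qed.

(** Testing against [step] and passing to the limit by dominated convergence shows that [d] is
    orthogonal to a function jumping at [x]. As it is also orthogonal to constants, its primitive
    vanishes at every interior point, and Lebesgue differentiation concludes. *)
Lemma du_bois_reymond (d : R -> R) : (forall x, x \notin `[0, 1] -> d x = 0) ->
  mu.-integrable setT (EFin \o d) ->
  (forall psi, C1S psi -> \int[mu]_(x in `[0, 1]) (d x * psi x) = 0) ->
  {ae mu, forall x, d x = 0}.
Proof.
move=> d0 id hd.
have /integrableP[/measurable_EFinP md _] := id.
have id1 : mu.-integrable `[0, 1] (EFin \o d) by exact: integrableS id.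
have prim0 (x : R) : 0 < x -> x < 1 -> prim d x = 0.
  move=> x0 x1.
  have lim0 : \int[mu]_(y in `[0, 1]) (d y * (pi / 2 * Num.sg (arc x y))) = 0.
    have ms n : measurable_fun setT (fun y => d y * step x n y).
      apply: measurable_funM => //; apply: continuous_measurable_fun => y.
      apply/differentiable_continuous/derivable1_diffP.
      exact: (@ex_derive _ _ _ _ _ _ _ (dstep x n y)).
    have cs y : d y * step x n y @[n --> \oo] --> d y * (pi / 2 * Num.sg (arc x y)).
      by apply: cvgM; [exact: cvg_cst|exact: step_cvg].
    have ml : measurable_fun setT (fun y => d y * (pi / 2 * Num.sg (arc x y))).
      by apply: (measurable_fun_cvg ms) => y _; exact: cs.
    have [] := @dominated_convergence _ _ R mu `[0, 1]%classic _
      (fun n y => (d y * step x n y)%:E)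
      (fun y => (d y * (pi / 2 * Num.sg (arc x y)))%:E)
      (fun y => `|(d y)%:E| * (pi / 2)%:E)%E.
    - exact: measurable_itv.
    - by move=> n; apply/measurable_EFinP; exact: (measurable_funTS (ms n)).
    - by apply/measurable_EFinP; exact: (measurable_funTS ml).
    - by apply: ae_all => y _; apply: cvg_EFin; [exact: nearW|exact: cs].
    - by apply: integrableZr => //; exact: integrable_abse.
    - apply: ae_all => y n _ /=; rewrite lee_fin normrM ler_wpM2l//.
      by rewrite ler_norml !ltW ?atan_gtNpi2 ?atan_ltpi2.
    move=> il _ cl.
    have is0 n : (\int[mu]_(y in `[0%R, 1%R]) (d y * step x n y)%:E = 0)%E.
      rewrite -[LHS]fineK; last first.
        apply: integrable_fin_num => //.
        apply: (le_integrable _ _ _ (integrableZr _ (pi / 2) (integrable_abse id1))) => //.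
          by apply/measurable_EFinP; exact: (measurable_funTS (ms n)).
        move=> y _ /=; rewrite lee_fin normrM [leRHS]normrM normr_id ler_wpM2l// [leRHS]ger0_norm ?divr_ge0 ?pi_ge0//.
        by rewrite ler_norml !ltW ?atan_gtNpi2 ?atan_ltpi2.
      by congr EFin; exact: hd (C1S_step x n).
    have := cl; under eq_fun do rewrite is0.
    rewrite /Rintegral => /cvg_lim <-//.
    by rewrite lim_cst.
  have id01 : mu.-integrable `[0, x] (EFin \o d) by exact: integrableS id.
  have int0 : \int[mu]_(y in `[0, 1]) d y = 0.
    rewrite -[RHS](hd _ (C1S_cst 1)); apply: eq_Rintegral => y _.
    by rewrite mulr1.
  (* On the unit interval, pi / 2 times the sign of [arc] is pi times the indicator of [0, x] minus
     pi / 2, except at 0, [x] and 1. *)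
  have : \int[mu]_(y in `[0, 1]) (pi * (d y * \1_`[0, x] y) - pi / 2 * d y) = 0.
    rewrite -[RHS]lim0; apply: ae_eq_Rintegral_nonmeas.
    apply: ae_mono2 (ae_and _ _ (ae_neq 0) (ae_neq 1)) (ae_neq x) => y [/eqP y0 /eqP y1] /eqP yx.
    rewrite /= in_itv/= => /andP[y0' y1'].
    have {}y0 : 0 < y by rewrite lt0r y0.
    have {}y1 : y < 1 by rewrite lt_neqAle y1.
    rewrite indicE mem_setE in_itv/= (ltW y0)/=.
    case: ltgtP yx => // yx _ /=.
      by rewrite gtr0_sg ?arc_gt0//; field.
    by rewrite ltr0_sg ?arc_lt0//; field.
  have ip : mu.-integrable `[0, 1] (EFin \o (fun y => d y * \1_`[0, x] y)).
    apply: (le_integrable _ _ _ id1) => //.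
      apply/measurable_EFinP/measurable_funTS/measurable_funM => //.
    move=> y _ /=; rewrite lee_fin normrM indicE.
    by case: (_ \in _); rewrite ?normr1 ?mulr1 ?normr0 ?mulr0.
  rewrite RintegralB//; last 2 first.
  - by have := integrableZl _ pi ip; apply.
  - by have := integrableZl _ (pi / 2) id1; apply.
  rewrite !RintegralZl// int0 mulr0 subr0 => /eqP.
  rewrite mulf_eq0 gt_eqF ?pi_gt0//= => /eqP <-.
  apply: esym; congr fine; apply: ae_restrict_eq_integral; apply: ae_all => y.
  rewrite !patchE indicE !mem_setE.
  have [y01|y01] := boolP (y \in `[0, 1]); last by rewrite d0// if_same.
  by case: ifP; rewrite ?mulr1 ?mulr0.
apply: ae_mono2 (ae_and _ _ (ae_neq 0) (ae_neq 1)) (ae_derive1_integral _ id) => z [/eqP z0 /eqP z1] h.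
have [z01|] := boolP (z \in `[0, 1]); last exact: d0.
have {}z0 : 0 < z by rewrite lt0r z0 (itvP z01).
have {}z1 : z < 1 by rewrite lt_neqAle z1 (itvP z01).
have [_ <-] := h z0.
rewrite derive1E -(derive_cst (0 : R) z (1 : R)); apply: near_eq_derive => //.
near=> y; apply: prim0.
  by near: y; exact: lt_nbhsr.
by near: y; exact: lt_nbhsl.
Unshelve. all: by end_near. Qed.

Lemma weak_derivative_unique (u1 u2 v1 v2 : R -> R) :
  {in `[0, 1], u1 =1 u2} -> H0 v1 -> H0 v2 ->
  weak_derivative u1 v1 -> weak_derivative u2 v2 -> aeS (fun x => v1 x = v2 x).
Proof.
move=> u12 /H0_L2S[w1 L1 vw1] /H0_L2S[w2 L2 vw2] d1 d2.
have [mw1 w10 _] := L1; have [mw2 w20 _] := L2.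
have i1 := L2S_integrable _ L1; have i2 := L2S_integrable _ L2.
have : {ae mu, forall x, w1 x - w2 x = 0}.
  apply: du_bois_reymond.
  - by move=> x x01; rewrite w10// w20// subrr.
  - exact: (integrableB measurableT i1 i2).
  move=> psi C1psi; have cpsi := C1S_continuous _ C1psi.
  under eq_Rintegral do rewrite mulrBl.
  have i1' : mu.-integrable `[0, 1] (EFin \o w1) by exact: integrableS i1.
  have i2' : mu.-integrable `[0, 1] (EFin \o w2) by exact: integrableS i2.
  rewrite RintegralB//; [|exact: integrable01M_continuous..].
  have e1 : \int[mu]_(x in `[0, 1]) (v1 x * psi x) = \int[mu]_(x in `[0, 1]) (w1 x * psi x).
    by apply: ae_eq_Rintegral_nonmeas; apply: ae_mono vw1 => x h /h ->.
  have e2 : \int[mu]_(x in `[0, 1]) (v2 x * psi x) = \int[mu]_(x in `[0, 1]) (w2 x * psi x).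
    by apply: ae_eq_Rintegral_nonmeas; apply: ae_mono vw2 => x h /h ->.
  apply/eqP; rewrite subr_eq0 -e1 -e2 -eqr_opp -d1// -d2//; apply/eqP.
  by apply: eq_Rintegral => x; rewrite inE/= => x01; rewrite u12.
move=> h; apply: ae_mono2 (ae_and _ _ vw1 vw2) h => x [h1 h2] h x01.
by rewrite h1// h2//; apply/eqP; rewrite -subr_eq0 h.
Qed.

End du_bois_reymond.

(** * Absolute continuity and explicit trigonometry *)

Section prim_absolutely_continuous.
Context {R : realType}.
Local Notation mu := (@lebesgue_measure R).

Lemma absolutely_continuous_prim (f : R -> R) :
  mu.-integrable setT (EFin \o f) -> absolutely_continuous (prim f).
Proof.
move=> intf e e0; have [d [d0 hd]] := integral_normr_continuous intf e0.
exists d => // n a b hab disj sumd.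
(* Half-open, because the given intervals may share end points and the sets must be disjoint. *)
pose F (i : 'I_n) : set R := `]a i, b i]%classic.
have mF i : measurable (F i) by exact: measurable_itv.
have intS (A : set R) : measurable A -> mu.-integrable A (EFin \o f).
  by move=> mA; exact: integrableS intf.
have intN (A : set R) : measurable A -> mu.-integrable A (EFin \o (fun x => `|f x|)).
  by move=> mA; have := integrable_abse (intS _ mA).
have tF : trivIset setT F.
  apply/trivIsetP => i j _ _ ij; apply/seteqP; split => // x [].
  rewrite /F/= !in_itv/= => /andP[ax xb] /andP[ax' xb'].
  by have [h|h] := disj i j ij; lra.
have muF i : mu (F i) = (b i - a i)%:E.
  have [_ [ab _]] := hab i.
  rewrite /F lebesgue_measure_itv/= lte_fin; case: ifPn => [_|]; first by rewrite EFinB.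
  by rewrite -leNgt => ba; congr EFin; apply/esym/eqP; rewrite subr_eq0 eq_le ab ba.
have incr i : `|prim f (b i) - prim f (a i)| <= \int[mu]_(x in F i) `|f x|.
  have [a0 [ab _]] := hab i.
  rewrite /prim Rintegral_itvB//; last first.
  - exact: intS.
  by apply: le_normr_Rintegral => //; exact: intS.
apply: (le_lt_trans (ler_sum _ (fun i _ => incr i))).
pose U := \big[setU/set0]_(i < n) F i.
have mU : measurable U by exact: bigsetU_measurable.
have -> : \sum_(i < n) \int[mu]_(x in F i) `|f x| = \int[mu]_(x in U) `|f x|.
  rewrite /Rintegral /U integral_bigsetU_EFin//.
  - by apply: sum_fine => i _; apply: integrable_fin_num; [exact: mF|exact: (intN _ (mF i))].
  - by rewrite /index_enum -enumT enum_uniq.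
  - exact: sub_trivIset tF.
  - by have /integrableP[] := intN _ mU.
apply: hd => //.
rewrite /U measure_bigsetU_ord// (eq_bigr (fun i => (b i - a i)%:E)); last by move=> i _; exact: muF.
by rewrite sumEFin lte_fin.
Qed.

End prim_absolutely_continuous.

Section angle.
Context {R : realType}.
Implicit Types a b s t : R.

(** For [a] = v / 2 and [b] = rho / 2 at a fixed point of the circle, this is phi_x as a function of
    time. Below, [speed'] is phi_xt and [speed_t] is f_t^2 + g_t^2. *)
Definition speed a b s : R := (cos s + a * sin s) ^+ 2 + (b * sin s) ^+ 2.

Definition speed' a b s : R :=
  2 * (cos s + a * sin s) * (a * cos s - sin s) + 2 * b ^+ 2 * (sin s * cos s).

Definition speed_t a b s : R := (a * cos s - sin s) ^+ 2 + (b * cos s) ^+ 2.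

Lemma is_derive_speed a b s : is_derive s 1 (speed a b) (speed' a b s).
Proof.
rewrite /speed; apply: is_derive_eq.
by rewrite /GRing.scale/= /speed'; ring.
Qed.

(** With z = f + i g one has z'' = -z, so the second derivative of |z|^2 is 2 |z'|^2 - 2 |z|^2. *)
Lemma is_derive_speed' a b s :
  is_derive s 1 (speed' a b) (2 * speed_t a b s - 2 * speed a b s).
Proof.
rewrite /speed'; apply: is_derive_eq.
by rewrite /GRing.scale/= /speed_t /speed; ring.
Qed.

Lemma speed_ge0 a b s : 0 <= speed a b s.
Proof. by rewrite addr_ge0// sqr_ge0. Qed.

Lemma speed_t_ge0 a b s : 0 <= speed_t a b s.
Proof. by rewrite addr_ge0// sqr_ge0. Qed.

Lemma speed_eq0 a b s : (speed a b s == 0) = (cos s + a * sin s == 0) && (b == 0).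
Proof.
rewrite /speed paddr_eq0 ?sqr_ge0// !sqrf_eq0 mulf_eq0.
have [_|b0]/= := eqVneq b 0; first by [].
have [s0|s0] := eqVneq (sin s) 0; last by [].
rewrite s0 mulr0 addr0 andbT andbF; apply/negP => /eqP c0.
by have /eqP := cos2Dsin2 s; rewrite s0 c0 expr0n/= addr0 eq_sym oner_eq0.
Qed.

Lemma speed_gt0 a b s : b != 0 -> 0 < speed a b s.
Proof. by move=> b0; rewrite lt0r speed_ge0 speed_eq0 (negbTE b0) andbF. Qed.

(* With z = (cos s + a sin s) + i b sin s, this is
   |z|^2 |z'|^2 = Re (conj z * z')^2 + Im (conj z * z')^2, and the imaginary part
   is the constant b. *)
Lemma speed'_sqr a b s :
  speed' a b s ^+ 2 + (2 * b) ^+ 2 = 4 * speed a b s * speed_t a b s.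
Proof.
have -> : (2 * b) ^+ 2 = 4 * b ^+ 2 * (cos s ^+ 2 + sin s ^+ 2) ^+ 2.
  by rewrite cos2Dsin2; ring.
by rewrite /speed' /speed /speed_t; ring.
Qed.

(** Conservation of |z|^2 + |z'|^2 for the harmonic oscillator z'' = -z. *)
Let speed_tE a b s : speed_t a b s = 1 + a ^+ 2 + b ^+ 2 - speed a b s.
Proof.
have -> : 1 + a ^+ 2 + b ^+ 2 = (1 + a ^+ 2 + b ^+ 2) * (cos s ^+ 2 + sin s ^+ 2).
  by rewrite cos2Dsin2 mulr1.
by rewrite /speed /speed_t; ring.
Qed.

(* For b > 0, a continuous branch (up to a constant) of the argument of
   z = (cos s + a sin s) + i b sin s: one has z = e^(is) (1 - i c) (1 + q e^(-2is)) / 2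
   with c = a + i b and |q| < 1, and the arctangent is the argument of the last
   factor. *)
Definition angle a b s : R := s + atan (speed' a b s / (2 * (speed a b s + b))).

Lemma is_derive_angle a b s : 0 < b -> is_derive s 1 (angle a b) (b / speed a b s).
Proof.
move=> b0.
have P0 : 0 < speed a b s by apply: speed_gt0; rewrite gt_eqF.
have Pb0 : 2 * (speed a b s + b) != 0 by rewrite gt_eqF// mulr_gt0// addr_gt0.
have h1 := is_derive_speed a b s; have h2 := is_derive_speed' a b s.
have h3 : is_derive s 1 (fun s => 2 * (speed a b s + b)) (2 * speed' a b s).
  by apply: is_derive_eq; rewrite /GRing.scale/=; ring.
have h4 := @is_deriveV R (fun s => 2 * (speed a b s + b)) s _ 1 Pb0 h3.
rewrite /angle; apply: is_derive_eq.
have [P_neq0 Pb_neq0] : speed a b s != 0 /\ speed a b s + b != 0.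
  by rewrite !gt_eqF// addr_gt0.
have m0 : (1 + b) ^+ 2 + a ^+ 2 != 0.
  by rewrite gt_eqF// ltr_wpDr ?sqr_ge0// exprn_gt0// addr_gt0.
have D2 : speed' a b s ^+ 2 = 4 * speed a b s * speed_t a b s - (2 * b) ^+ 2.
  by rewrite -speed'_sqr addrK.
rewrite /GRing.scale/= expr_div_n D2 speed_tE.
rewrite speed_tE in D2; move: D2 P_neq0 Pb_neq0.
set P := speed a b s; set D := speed' a b s => D2 P_neq0 Pb_neq0.
have -> : D * (- (2 * (P + b)) ^- 2 * (2 * D)) = - (2 * (P + b)) ^- 2 * 2 * D ^+ 2 by ring.
rewrite D2.
set E := 1 + (4 * P * _ - _) / _.
(* After [speed_tE] the terms P^2 and b^2 of the numerator cancel; the factor P that comes out is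
   the one in the denominator of [b / speed a b s]. *)
have -> : E = P * ((1 + b) ^+ 2 + a ^+ 2) / (P + b) ^+ 2.
  by rewrite /E; field.
field.
by rewrite P_neq0 Pb_neq0 m0.
Qed.

Lemma speed_norm a b s : speed a `|b| s = speed a b s.
Proof. by rewrite /speed !exprMn real_normK// num_real. Qed.

Lemma continuous_speed a b : continuous (speed a b).
Proof.
move=> s; apply/differentiable_continuous/derivable1_diffP.
exact: (@ex_derive _ _ _ _ _ _ _ (is_derive_speed a b s)).
Qed.

Lemma continuous_inv_speed a b : b != 0 -> continuous (fun s => (speed a b s)^-1).
Proof.
move=> b0 s; apply: cvgV; first by rewrite gt_eqF// speed_gt0.
exact: continuous_speed.
Qed.

(** [angle] is a primitive only for a positive second parameter; since [speed] is even in [b], the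
    absolute value may be used. *)
Lemma integral_inv_speed a b t : b != 0 -> 0 <= t ->
  \int[lebesgue_measure]_(s in `[0, t]) (speed a b s)^-1 =
  (angle a `|b| t - angle a `|b| 0) / `|b|.
Proof.
move=> b0; have nb0 : 0 < `|b| by rewrite normr_gt0.
rewrite le_eqVlt => /predU1P[<-|t0].
  by rewrite set_itv1 Rintegral_set1 subrr mul0r.
pose F s := angle a `|b| s / `|b|.
have dF s : is_derive s 1 F (speed a b s)^-1.
  have h := is_derive_angle a _ s nb0.
  rewrite /F; apply: is_derive_eq.
  by rewrite /GRing.scale/= speed_norm; field; rewrite !gt_eqF ?speed_gt0.
have cF : continuous F.
  move=> s; apply/differentiable_continuous/derivable1_diffP.
  exact: (@ex_derive _ _ _ _ _ _ _ (dF s)).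
have LR : derivable_oo_LRcontinuous F 0 t.
  split; first by move=> x _; exact: (@ex_derive _ _ _ _ _ _ _ (dF x)).
  - exact/cvg_at_right_filter/cF.
  - exact/cvg_at_left_filter/cF.
have ci : {within `[0, t], continuous (fun s => (speed a b s)^-1)}.
  by apply: continuous_subspaceT; exact: continuous_inv_speed.
rewrite /Rintegral (continuous_FTC2 t0 ci LR) /=; last first.
  by move=> x _; rewrite derive1E; exact: (@derive_val _ _ _ _ _ _ _ (dF x)).
by rewrite /F -mulrBl.
Qed.

Lemma angle_le a b t : 0 <= t -> `|angle a b t - angle a b 0| <= t + pi.
Proof.
move=> t0; rewrite /angle add0r.
set x := speed' a b t / _; set y := speed' a b 0 / _.
have := atan_gtNpi2 x; have := atan_gtNpi2 y.
have := atan_ltpi2 x; have := atan_ltpi2 y.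
by rewrite ler_norml => ? ? ? ?; apply/andP; split; lra.
Qed.

Lemma sin_eq0P s : sin s = 0 -> exists n, s = pi * n%:R \/ s = - (pi * n%:R).
Proof.
have main (r : R) : 0 <= r -> sin r = 0 -> exists n, r = pi * n%:R.
  move=> r0 sr; exists (Num.truncn (r / pi)).
  set n := Num.truncn _.
  have /andP[nr rn] : (n%:R <= r / pi < n.+1%:R).
    by apply: truncn_itv; rewrite divr_ge0// pi_ge0.
  pose q := r - pi * n%:R.
  have p0 := @pi_gt0 R.
  have q0 : 0 <= q by rewrite /q subr_ge0 mulrC -ler_pdivlMr.
  have qpi : q < pi.
    move: rn; rewrite ltr_pdivrMr// -addn1 natrD mulrDl mul1r /q.
    by rewrite [n%:R * _]mulrC => rn; lra.
  have sq : sin q = 0.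
    have := alternatingn (@sinDpi R) n q.
    rewrite /q -[pi *+ n]mulr_natr subrK sr => /esym/eqP; rewrite mulf_eq0 => /orP[|/eqP//].
    by rewrite signr_eq0.
  have [q0'|] := ltP 0 q.
    by have := @sin_gt0_pi R q; rewrite q0' qpi sq ltxx => /(_ isT).
  move=> q0'; have /eqP : q = 0 by apply/le_anti; rewrite q0' q0.
  by rewrite /q subr_eq0 => /eqP.
move=> s0; have [h|h] := leP 0 s.
  by have [n ->] := main s h s0; exists n; left.
have [||n hn] := main (- s); first by rewrite oppr_ge0 ltW.
  by rewrite sinN s0 oppr0.
by exists n; right; rewrite -hn opprK.
Qed.

(** At two zeros [t0] and [t] the cosine is [- a] times the sine, hence sin (t - t0) = 0: the zeros
    lie in the countable set t0 + pi Z. *)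
Lemma ae_speed_neq0 a b : {ae lebesgue_measure, forall t : R, speed a b t != 0}.
Proof.
have [[t0 ht0]|h0] := pselect (exists t0, speed a b t0 = 0); last first.
  by apply: ae_all => t; apply/eqP => ht; apply: h0; exists t.
have [/eqP c0 /eqP b0] : cos t0 + a * sin t0 == 0 /\ b == 0.
  by move/eqP: ht0; rewrite speed_eq0 => /andP.
have : (@lebesgue_measure R).-negligible (\bigcup_n [set t0 + pi * n%:R; t0 - pi * n%:R]).
  apply: negligible_bigcup => n; apply: negligibleU; apply/negligibleP => //;
    exact: lebesgue_measure_set1.
move=> [N [mN N0 subN]]; exists N; split => // t /= /negP; rewrite negbK.
rewrite speed_eq0 => /andP[/eqP ct _]; apply: subN.
have st : sin (t - t0) = 0.
  rewrite sinB.
  have -> : cos t = - a * sin t by rewrite mulNr; apply/eqP; rewrite -addr_eq0 ct.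
  have -> : cos t0 = - a * sin t0 by rewrite mulNr; apply/eqP; rewrite -addr_eq0 c0.
  by ring.
have [n [hn|hn]] := sin_eq0P _ st; exists n => //=; [left|right];
  by rewrite -hn addrC subrK.
Qed.

End angle.

(** * Factorization through a monotone primitive *)

Section pullback.
Context {R : realType}.
Local Notation mu := (@lebesgue_measure R).

Lemma ae_le_integrable (f g : R -> R) : measurable_fun setT f ->
  {ae mu, forall x, `|f x| <= g x} ->
  mu.-integrable setT (EFin \o g) -> mu.-integrable setT (EFin \o f).
Proof.
move=> mf fg /integrableP[/measurable_EFinP mg ig]; apply/integrableP; split.
  exact/measurable_EFinP.
apply: le_lt_trans ig; apply: ae_ge0_le_integral => //.
- by apply: measurableT_comp => //; exact/measurable_EFinP.
- by apply: measurableT_comp => //; exact/measurable_EFinP.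
- by apply: ae_mono fg => x h _; rewrite /= lee_fin (le_trans h)// ler_norm.
Qed.

(** The inverse is the pointwise limit of y / (y^2 + 1 / (n + 1)), also at [y = 0], where both the
    sequence and the conventional inverse are 0. *)
Lemma measurable_funV (f : R -> R) : measurable_fun setT f ->
  measurable_fun setT (fun x => (f x)^-1).
Proof.
move=> mf; have inv_cvg (y : R) : y / (y ^+ 2 + n.+1%:R^-1) @[n --> \oo] --> y^-1.
  have [->|y0] := eqVneq y 0.
    by under eq_fun do rewrite mul0r; rewrite invr0; exact: cvg_cst.
  have -> : y^-1 = y / (y ^+ 2 + 0) by rewrite addr0; field.
  apply: cvgM; first exact: cvg_cst.
  apply: cvgV; first by rewrite addr0 expf_neq0.
  by apply: cvgD; [exact: cvg_cst|exact: cvg_harmonic].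
apply: (measurable_fun_cvg (h := fun n x => f x / (f x ^+ 2 + n.+1%:R^-1))) => [n|x _].
  apply: measurable_funM => //.
  apply: (measurableT_comp (f := fun y : R => (y ^+ 2 + n.+1%:R^-1)^-1)) => //.
  apply: continuous_measurable_fun => y; apply: cvgV.
    by rewrite gt_eqF// ltr_wpDl ?sqr_ge0// invr_gt0.
  by apply: cvgD; [exact: exprn_continuous|exact: cvg_cst].
exact: inv_cvg.
Qed.

Variable P : R -> R.
Hypothesis mP : measurable_fun setT P.
Hypothesis P0 : forall x, 0 <= P x.
Hypothesis Pout : forall x, x \notin `[0, 1] -> P x = 0.
Hypothesis P1 : (\int[mu]_x (P x)%:E = 1)%E.

(* The factor is [k] composed with [prim_inv P], once [k] has been killed on the
   null set where the level set of a non-critical point may fail to be a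
   singleton. *)
Lemma prim_factor (k : R -> R) : measurable_fun setT k ->
  (forall x, P x = 0 -> k x = 0) ->
  exists kappa : R -> R, [/\ measurable_fun setT kappa,
    forall y, y \notin `[0, 1] -> kappa y = 0
  & aeS (fun x => kappa (prim P x) = k x)].
Proof.
move=> mk k0.
have [N [mN N0 hN]] := ae_prim_level _ mP P0 Pout P1.
have good z : ~ N z -> P z != 0 -> forall x, prim P x = prim P z -> x = z.
  by move=> Nz Pz; have [_ [_]] : _ := contra_notP (hN z) Nz Pz.
pose k' x := k x * \1_(~` N) x.
have mk' : measurable_fun setT k'.
  by apply: measurable_funM => //; apply: measurable_indic; exact: measurableC.
exists (fun y => k' (prim_inv P y) * \1_`[0, 1] y); split.
- apply: measurable_funM.
    exact: (measurableT_comp mk' (measurable_prim_inv P P0)).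
  by apply: measurable_indic; exact: measurable_itv.
- by move=> y y01; rewrite indicE memNset ?mulr0//=; exact/negP.
exists N; split => // x /=; apply: contra_notP => Nx x01.
have px01 : prim P x \in `[0, 1] by exact: prim_itv.
rewrite indicE mem_set// mulr1.
have := prim_invK _ mP P0 Pout P1 _ px01; set x' := prim_inv _ _ => x'x.
have [Px|Px] := eqVneq (P x) 0; last first.
  by rewrite (good _ Nx Px _ x'x) /k' indicE mem_set ?mulr1.
rewrite k0// /k' indicE; have [|Nx'] := boolP (x' \in ~` N); last by rewrite mulr0.
rewrite inE => /= Nx'; rewrite mulr1.
(* [x] and [x'] share a level set. Were [x'] non-critical, it would be alone there, hence equal to
   [x], where [P] is 0. *)
have [/k0//|Px'] := eqVneq (P x') 0.
have xx' := good _ Nx' Px' _ (esym x'x).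
by rewrite -xx' Px eqxx in Px'.
Qed.

End pullback.

Section combinations.
Context {R : realType}.
Local Notation mu := (@lebesgue_measure R).
Variables v0 r0 : R -> R.
Hypotheses (L2v : L2S v0) (L2r : L2S r0).
Implicit Types al be ga : R.

Definition energy_density x : R := v0 x ^+ 2 + r0 x ^+ 2.

(** phi_x, phi_xt and the kinetic density all have this form at every time. The indicator confines
    the constant term to the circle. *)
Definition comb al be ga x : R :=
  \1_`[0, 1] x * (al + be * v0 x + ga * energy_density x).

Let V := prim v0.
Let W := prim energy_density.

Let iv : mu.-integrable setT (EFin \o v0). Proof. exact: L2S_integrable. Qed.

Lemma integrable_energy_density : mu.-integrable setT (EFin \o energy_density).
Proof.
have [_ _ i1] := L2v; have [_ _ i2] := L2r.
exact: (integrableD measurableT i1 i2).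
Qed.

Let combE al be ga x :
  comb al be ga x = al * \1_`[0, 1] x + be * v0 x + ga * energy_density x.
Proof.
have [_ v00 _] := L2v; have [_ r00 _] := L2r.
rewrite /comb indicE mem_setE; have [x01|x01]/= := boolP (x \in `[0, 1]); first by ring.
by rewrite /energy_density v00// r00//; ring.
Qed.

Lemma integrable_comb al be ga : mu.-integrable setT (EFin \o comb al be ga).
Proof.
apply: (@eq_integrable _ _ _ mu _ measurableT
  (fun x => (al%:E * (\1_`[0%R, 1%R] x)%:E + be%:E * (v0 x)%:E +
             ga%:E * (energy_density x)%:E)%E)).
  by move=> x _ /=; rewrite combE.
apply: integrableD => //; last first.
  by apply: integrableZl => //; exact: integrable_energy_density.
apply: integrableD => //; apply: integrableZl => //.
exact: integrable_indic01.
Qed.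

Lemma measurable_comb al be ga : measurable_fun setT (comb al be ga).
Proof. by have /integrableP[/measurable_EFinP] := integrable_comb al be ga. Qed.

Lemma prim_comb al be ga x : x \in `[0, 1] ->
  prim (comb al be ga) x = al * x + be * prim v0 x + ga * prim energy_density x.
Proof.
move=> x01; rewrite /prim.
have iS (f : R -> R) : mu.-integrable setT (EFin \o f) -> mu.-integrable `[0, x] (EFin \o f).
  by apply: integrableS.
have i1 := iS _ integrable_indic01; have i2 := iS _ iv.
have i3 := iS _ integrable_energy_density.
have h1 : mu.-integrable `[0, x] (EFin \o (fun y => al * \1_`[0, 1] y)).
  by have := integrableZl _ al i1; apply.
have h2 : mu.-integrable `[0, x] (EFin \o (fun y => be * v0 y)).
  by have := integrableZl _ be i2; apply.
have h3 : mu.-integrable `[0, x] (EFin \o (fun y => ga * energy_density y)).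
  by have := integrableZl _ ga i3; apply.
have h12 : mu.-integrable `[0, x] (EFin \o (fun y => al * \1_`[0, 1] y + be * v0 y)).
  by have := integrableD _ h1 h2; apply.
under eq_Rintegral do rewrite combE.
rewrite RintegralD// RintegralD// !RintegralZl//.
congr (_ * _ + _ + _).
transitivity (\int[mu]_(y in `[0, x]) (cst 1 y : R)).
  apply: eq_Rintegral => y; rewrite inE/= in_itv/= => /andP[y0 yx].
  by rewrite indicE mem_setE in_itv/= y0 (le_trans yx)// (itvP x01).
have mux : mu (`[0, x]%classic : set R) = x%:E.
  rewrite lebesgue_measure_itv/= lte_fin; case: ifPn => [_|]; first by rewrite -EFinB subr0.
  by rewrite -leNgt => x0; congr EFin; apply/esym/le_anti; rewrite x0 (itvP x01).
by rewrite Rintegral_cst// mul1r -[RHS]/(fine x%:E); congr fine; exact: mux.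
Qed.

Lemma prim_comb1 al be ga : \int[mu]_(x in `[0, 1]) v0 x = 0 ->
  \int[mu]_(x in `[0, 1]) energy_density x = 4 ->
  prim (comb al be ga) 1 = al + 4 * ga.
Proof.
move=> V1 W1; rewrite prim_comb ?in_itv/= ?ler01 ?lexx//.
by rewrite /prim V1 W1; ring.
Qed.

Lemma comb_out al be ga x : x \notin `[0, 1] -> comb al be ga x = 0.
Proof. by move=> x01; rewrite /comb indicE mem_setE (negbTE x01) mul0r. Qed.

Lemma integral_comb al be ga :
  (\int[mu]_x (comb al be ga x)%:E = (prim (comb al be ga) 1)%:E)%E.
Proof.
rewrite /prim /Rintegral fineK; last first.
  by apply: integrable_fin_num => //; exact: integrableS (integrable_comb _ _ _).
apply: ae_restrict_eq_integral; apply: ae_all => x; rewrite patch_setT patchE mem_setE.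
by case: ifPn => // x01; rewrite comb_out.
Qed.

(** Independent of the coefficients [al], [be], [ga]: at such a point the primitives of all
    combinations, hence those of all times, are differentiable. *)
Definition differentiation_point (x : R) : Prop :=
  [/\ 0 < x < 1, is_derive x 1 (prim v0) (v0 x)
    & is_derive x 1 (prim energy_density) (energy_density x)].

Lemma ae_differentiation_point : aeS differentiation_point.
Proof.
have h1 := ae_derive1_integral _ iv.
have h2 := ae_derive1_integral _ integrable_energy_density.
apply: ae_mono2 (ae_and _ _ h1 h2) (ae_and _ _ (ae_neq 0) (ae_neq 1)) => x.
move=> [h3 h4] [/eqP x0 /eqP x1] x01.
have {}x0 : 0 < x by rewrite lt0r x0 (itvP x01).
have {}x1 : x < 1 by rewrite lt_neqAle x1 (itvP x01).
have [d1 e1] := h3 x0; have [d2 e2] := h4 x0.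
split; first by rewrite x0.
- by have := derivableP d1; rewrite -derive1E e1.
- by have := derivableP d2; rewrite -derive1E e2.
Qed.

Lemma is_derive_prim_comb al be ga (f : R -> R) x : differentiation_point x ->
  {in `[0, 1], f =1 prim (comb al be ga)} -> is_derive x 1 f (comb al be ga x).
Proof.
move=> [/andP[x0 x1] dV dW] fE.
have : is_derive x 1 (fun x => al * x + be * V x + ga * W x) (comb al be ga x).
  have -> : comb al be ga x = al + be * v0 x + ga * energy_density x.
    by rewrite combE indicE mem_setE in_itv/= !ltW//= mulr1.
  by apply: is_derive_eq; rewrite /GRing.scale/=; ring.
move=> h; apply: (@near_eq_is_derive _ _ _ (fun x => al * x + be * V x + ga * W x) f x 1 _ _ h).
near=> y.
have y01 : y \in `[0, 1].
  rewrite in_itv/=; apply/andP; split; apply: ltW.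
    by near: y; exact: lt_nbhsr.
  by near: y; exact: lt_nbhsl.
by rewrite fE// prim_comb.
Unshelve. all: by end_near. Qed.

End combinations.

(** * Velocity and acceleration along the geodesic *)

Section geodesic.
Context {R : realType}.
Local Notation mu := (@lebesgue_measure R).
Variables v0 r0 : R -> R.
Hypotheses (L2v : L2S v0) (L2r : L2S r0).
Hypothesis V1 : \int[mu]_(x in `[0, 1]) v0 x = 0.
Hypothesis W1 : \int[mu]_(x in `[0, 1]) energy_density v0 r0 x = 4.

(* The integrands of phi, of its time derivative, and of the kinetic energy
   f_t^2 + g_t^2; note that phi_xtt = 2 kinetic - 2 phi_x since f_tt = - f. *)
Definition phi_x (t : R) :=
  comb v0 r0 (cos t ^+ 2) (cos t * sin t) (sin t ^+ 2 / 4).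

Definition phi_xt (t : R) :=
  comb v0 r0 (- 2 * (cos t * sin t)) (cos t ^+ 2 - sin t ^+ 2) (sin t * cos t / 2).

Definition kinetic (t : R) :=
  comb v0 r0 (sin t ^+ 2) (- (cos t * sin t)) (cos t ^+ 2 / 4).

Let comb01 al be ga x : x \in `[0, 1] ->
  comb v0 r0 al be ga x = al + be * v0 x + ga * energy_density v0 r0 x.
Proof. by move=> x01; rewrite /comb indicE mem_setE x01 mul1r. Qed.

Lemma phi_xE t x : x \in `[0, 1] -> phi_x t x = speed (v0 x / 2) (r0 x / 2) t.
Proof. by move=> x01; rewrite /phi_x comb01// /speed /energy_density; field. Qed.

Lemma phi_xtE t x : x \in `[0, 1] -> phi_xt t x = speed' (v0 x / 2) (r0 x / 2) t.
Proof. by move=> x01; rewrite /phi_xt comb01// /speed' /energy_density; field. Qed.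

Lemma kineticE t x : x \in `[0, 1] -> kinetic t x = speed_t (v0 x / 2) (r0 x / 2) t.
Proof. by move=> x01; rewrite /kinetic comb01// /speed_t /energy_density; field. Qed.

Lemma phi_x_ge0 t x : 0 <= phi_x t x.
Proof.
have [x01|x01] := boolP (x \in `[0, 1]); last by rewrite /phi_x comb_out.
by rewrite phi_xE// speed_ge0.
Qed.

Lemma kinetic_ge0 t x : 0 <= kinetic t x.
Proof.
have [x01|x01] := boolP (x \in `[0, 1]); last by rewrite /kinetic comb_out.
by rewrite kineticE// speed_t_ge0.
Qed.

Lemma phi_x_out t x : x \notin `[0, 1] -> phi_x t x = 0.
Proof. exact: comb_out. Qed.

Lemma measurable_phi_x t : measurable_fun setT (phi_x t).
Proof. exact: measurable_comb. Qed.

Lemma integral_phi_x t : (\int[mu]_x (phi_x t x)%:E = 1)%E.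
Proof.
rewrite /phi_x integral_comb// prim_comb1//; congr EFin.
by rewrite [4 * _]mulrC divfK// cos2Dsin2.
Qed.

Lemma integral_kinetic t : (\int[mu]_x (kinetic t x)%:E = 1)%E.
Proof.
rewrite /kinetic integral_comb// prim_comb1//; congr EFin.
by rewrite [4 * _]mulrC divfK// addrC cos2Dsin2.
Qed.

Lemma phi_xt_sqr t x : phi_xt t x ^+ 2 + r0 x ^+ 2 = 4 * phi_x t x * kinetic t x.
Proof.
have [_ r00 _] := L2r.
have [x01|x01] := boolP (x \in `[0, 1]); last first.
  by rewrite /phi_x /kinetic /phi_xt !comb_out// r00// expr0n mulr0 addr0.
by rewrite phi_xE// kineticE// phi_xtE// -speed'_sqr [2 * _]mulrC divfK.
Qed.

Lemma phi_x_eq0 t x : phi_x t x = 0 -> phi_xt t x = 0 /\ r0 x = 0.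
Proof.
move=> P0; have /eqP := phi_xt_sqr t x.
rewrite P0 mulr0 mul0r paddr_eq0 ?sqr_ge0// !sqrf_eq0.
by move=> /andP[/eqP -> /eqP ->].
Qed.

(** The integrand of the Eulerian energy pulled back by phi. On the critical set the quotients are 0
    by the convention for division, so the kinetic density is lost exactly there. *)
Lemma phi_xt_div_sqr t x :
  ((phi_xt t x / phi_x t x) ^+ 2 + (r0 x / phi_x t x) ^+ 2) * phi_x t x =
  if phi_x t x == 0 then 0 else 4 * kinetic t x.
Proof.
case: eqVneq => [->|P0]; first by rewrite mulr0.
by rewrite !expr_div_n -mulrDl phi_xt_sqr; field.
Qed.

(** [v1] and [r1] are the space derivative of the Eulerian velocity and the Eulerian density. *)
Lemma velocity_pullback t : exists v1 r1 : R -> R,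
  [/\ L2S v1 /\ L2S r1,
      aeS (fun x => v1 (prim (phi_x t) x) = phi_xt t x / phi_x t x),
      aeS (fun x => r1 (prim (phi_x t) x) = r0 x / phi_x t x),
      \int[mu]_(x in `[0, 1]) v1 x = 0 &
      forall x, x \in `[0, 1] -> prim v1 (prim (phi_x t) x) = prim (phi_xt t) x].
Proof.
have [mr0 r00 _] := L2r.
have mP := measurable_phi_x t; have P0 := phi_x_ge0 t; have Pout := phi_x_out t.
have P1 := integral_phi_x t.
have mD : measurable_fun setT (phi_xt t) by exact: measurable_comb.
have mVP := measurable_funV _ mP.
have k1 x : phi_x t x = 0 -> phi_xt t x / phi_x t x = 0.
  by move=> ->; rewrite invr0 mulr0.
have k2 x : phi_x t x = 0 -> r0 x / phi_x t x = 0.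
  by move=> ->; rewrite invr0 mulr0.
have [v1 [mv1 v1out v1E]] := prim_factor _ mP P0 Pout P1 _ (measurable_funM mD mVP) k1.
have [r1 [mr1 r1out r1E]] := prim_factor _ mP P0 Pout P1 _ (measurable_funM mr0 mVP) k2.
have mprim := measurable_prim _ mP P0 Pout P1.
have iQ : mu.-integrable setT (EFin \o (fun x => 4 * kinetic t x)).
  have := integrableZl _ 4 (integrable_comb _ _ L2v L2r (sin t ^+ 2) (- (cos t * sin t)) (cos t ^+ 2 / 4)).
  by apply.
(* By change of variables, square integrability of [w] is integrability of its pulled back square
   times phi_x, which the kinetic density dominates. *)
have L2 (w : R -> R) : measurable_fun setT w -> (forall y, y \notin `[0, 1] -> w y = 0) ->
    {ae mu, forall x, w (prim (phi_x t) x) ^+ 2 * phi_x t x <= 4 * kinetic t x} -> L2S w.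
  move=> mw wout hw; split => //.
  have mw2 : measurable_fun setT (fun y => w y ^+ 2) by exact: measurable_funX.
  have i01 : mu.-integrable `[0, 1] (EFin \o (fun y => w y ^+ 2)).
    apply: (integrable_prim _ mP P0 Pout P1) => //.
    apply: (ae_le_integrable _ (fun x => 4 * kinetic t x)) => //.
      apply: measurable_funM => //; exact: (measurableT_comp mw2 mprim).
    apply: ae_mono hw => x; apply: le_trans.
    by rewrite ger0_norm// mulr_ge0 ?sqr_ge0.
  have : mu.-integrable setT ((EFin \o (fun y => w y ^+ 2)) \_ `[0, 1]).
    by apply: (integrable_mkcond _ _).1 => //; exact: measurable_itv.
  apply: eq_integrable => // x _; rewrite patchE mem_setE/=.
  by case: ifPn => // x01; rewrite wout// expr0n.
have bound x : (x \in `[0, 1] -> v1 (prim (phi_x t) x) = phi_xt t x / phi_x t x) /\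
    (x \in `[0, 1] -> r1 (prim (phi_x t) x) = r0 x / phi_x t x) ->
    (v1 (prim (phi_x t) x) ^+ 2 + r1 (prim (phi_x t) x) ^+ 2) * phi_x t x <= 4 * kinetic t x.
  move=> [h1 h2]; have [x01|x01] := boolP (x \in `[0, 1]).
    rewrite h1// h2// phi_xt_div_sqr; case: ifP => // _.
    by rewrite mulr_ge0// kinetic_ge0.
  by rewrite Pout// mulr0 mulr_ge0// kinetic_ge0.
have primvE x : x \in `[0, 1] -> prim v1 (prim (phi_x t) x) = prim (phi_xt t) x.
  move=> x01; rewrite {1}/prim (Rintegral_prim _ mP P0 Pout P1)//.
  apply: ae_eq_Rintegral_nonmeas; apply: ae_mono v1E => z h.
  rewrite /= in_itv/= => /andP[z0 zx].
  have -> : v1 (prim (phi_x t) z) = phi_xt t z / phi_x t z.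
    by apply: h; rewrite in_itv/= z0 (le_trans zx)// (itvP x01).
  (* phi_xt vanishes wherever phi_x does, so dividing by phi_x and multiplying back is harmless. *)
  have [Pz|Pz] := eqVneq (phi_x t z) 0; first by rewrite Pz mulr0 (phi_x_eq0 _ _ Pz).1.
  by rewrite divfK.
exists v1, r1; split => //.
- split; apply: L2 => //; apply: ae_mono2 v1E r1E => x h1 h2;
    have := bound x (conj h1 h2); apply: le_trans; rewrite mulrDl ?lerDl ?lerDr mulr_ge0 ?sqr_ge0//.
(* The mean of [v1] is the total integral of phi_xt, namely - 2 cos t sin t + 4 (sin t cos t / 2) =
   0; this makes its primitive periodic. *)
- have := primvE 1; rewrite in_itv/= ler01 lexx => /(_ isT).
  rewrite (prim1 _ mP P0 Pout P1)// {1}/prim => ->; rewrite /phi_xt prim_comb1//; lra.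
Qed.

Lemma prim_continuous01 (f : R -> R) : mu.-integrable setT (EFin \o f) ->
  {within `[0, 1], continuous (prim f)}.
Proof.
move=> intf; apply: parameterized_integral_continuous => //.
exact: integrableS intf.
Qed.

Lemma H1_prim (f : R -> R) : L2S f -> \int[mu]_(x in `[0, 1]) f x = 0 ->
  H1 (prim f) f.
Proof.
move=> L2f f1; have [mf fout _] := L2f; have intf := L2S_integrable _ L2f.
split.
- exact: prim_continuous01.
- by rewrite {1}/prim set_itv1 Rintegral_set1 /prim f1.
- exact: L2S_H0.
- by move=> psi C1psi; exact: weak_derivative_prim_psi.
Qed.

Section translate.
Variables (t : R) (phi U F : R -> R).
Hypothesis phiE : {in `[0, 1], phi =1 prim (phi_x t)}.
Hypothesis UE : {in `[0, 1], U =1 prim (phi_xt t)}.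
Hypothesis FE : aeS (fun x => F x = r0 x / phi_x t x).

Lemma tangent_geodesic : tangent phi U F.
Proof.
have [v1 [r1 [[L2v1 L2r1] v1E r1E v11 primE]]] := velocity_pullback t.
exists (prim v1), v1, r1; split.
- exact: H1_prim.
- by rewrite /prim set_itv1 Rintegral_set1.
- exact: L2S_H0.
- by move=> x x01; rewrite phiE// primE// UE.
- by apply: ae_mono2 FE r1E => x h1 h2 x01; rewrite h1// phiE// h2.
Qed.

(** phi is onto, so [u1] is forced on the whole unit interval, and [v1] almost everywhere by
    uniqueness of weak derivatives. As phi_x is almost nowhere 0, these equalities survive
    composition with phi. *)
Lemma christoffel_geodesic (u1 v1 r1 : R -> R) :
  {ae mu, forall x, x \in `[0, 1] -> phi_x t x != 0} ->
  right_translate phi U F u1 v1 r1 ->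
  (forall x, x \in `[0, 1] ->
     Gamma1 v1 r1 (phi x) = 2 * prim (kinetic t) x - 2 * prim (phi_x t) x) /\
  aeS (fun x => Gamma2 v1 r1 (phi x) = - (phi_xt t x * r0 x / phi_x t x ^+ 2)).
Proof.
move=> Pn0 [[_ _ H0v1 wd1] u10 H0r1 UE1 FE1].
have [v2 [r2 [[L2v2 L2r2] v2E r2E v21 primE]]] := velocity_pullback t.
have mP := measurable_phi_x t; have P0 := phi_x_ge0 t; have Pout := phi_x_out t.
have P1 := integral_phi_x t.
have [_ _ H0v2 wd2] := H1_prim _ L2v2 v21.
have uE : {in `[0, 1], u1 =1 prim v2}.
  move=> y y01; have y0 : 0 <= y by rewrite (itvP y01).
  have s01 : prim_inv (phi_x t) y \in `[0, 1] by apply: prim_inv_itv.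
  have sK := prim_invK _ mP P0 Pout P1 _ y01.
  by rewrite -[in LHS]sK -phiE// -UE1// UE// -primE// sK.
have v12 := weak_derivative_unique _ _ _ _ uE H0v1 H0v2 wd1 wd2.
(* [r1] may fail to be Borel, whereas the change of variables requires a Borel function. *)
have [r3 L2r3 r13] := H0_L2S _ H0r1.
have v1E : aeS (fun x => v1 (prim (phi_x t) x) = phi_xt t x / phi_x t x).
  have := ae_prim _ mP P0 Pout P1 _ v12.
  apply: ae_mono2 (ae_and _ _ Pn0 v2E) => x [h1 h2] h3 x01.
  by rewrite h3 ?h1// h2.
have r1E : aeS (fun x => r1 (prim (phi_x t) x) = r0 x / phi_x t x).
  by apply: ae_mono2 FE FE1 => x h1 h2 x01; rewrite -phiE// -h2// h1.
have r3E : aeS (fun x => r3 (prim (phi_x t) x) = r0 x / phi_x t x).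
  have := ae_prim _ mP P0 Pout P1 _ r13.
  apply: ae_mono2 (ae_and _ _ Pn0 r1E) => x [h1 h2] h3 x01.
  by rewrite -h3 ?h1// h2.
have [mv2 _ _] := L2v2; have [mr3 _ _] := L2r3.
have key x : x \in `[0, 1] ->
    \int[mu]_(y in `[0, prim (phi_x t) x]) (v1 y ^+ 2 + r1 y ^+ 2) = 4 * prim (kinetic t) x.
  move=> x01.
  transitivity (\int[mu]_(y in `[0, prim (phi_x t) x]) (v2 y ^+ 2 + r3 y ^+ 2)).
    apply: ae_eq_Rintegral_nonmeas; apply: ae_mono2 v12 r13 => y h1 h2.
    rewrite /= in_itv/= => /andP[y0 yx].
    have y01 : y \in `[0, 1].
      by rewrite in_itv/= y0 (le_trans yx)// (prim_le1 _ mP P0 Pout P1).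
    by rewrite h1// h2.
  rewrite (Rintegral_prim _ mP P0 Pout P1 (fun y => v2 y ^+ 2 + r3 y ^+ 2))//; last first.
    by apply: measurable_funD; exact: measurable_funX.
  rewrite /prim -RintegralZl//; last first.
    by apply: integrableS (integrable_comb _ _ L2v L2r _ _ _).
  apply: ae_eq_Rintegral_nonmeas; apply: ae_mono2 (ae_and _ _ v2E r3E) Pn0 => z [h1 h2] h3.
  rewrite /= in_itv/= => /andP[z0 zx].
  have z01 : z \in `[0, 1] by rewrite in_itv/= z0 (le_trans zx)// (itvP x01).
  by rewrite h1// h2// phi_xt_div_sqr (negbTE (h3 z01)).
split.
  move=> x x01; rewrite /Gamma1 phiE// key//.
  have := key 1; rewrite in_itv/= ler01 lexx => /(_ isT).
  rewrite (prim1 _ mP P0 Pout P1)// => ->.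
  (* The total Eulerian energy is thus 4, and the linear term of [Gamma1] becomes twice phi. *)
  have -> : prim (kinetic t) 1 = 1.
    by apply: EFin_inj; rewrite /kinetic -integral_comb// -/(kinetic t) integral_kinetic.
  by field.
apply: ae_mono2 v1E r1E => x h1 h2 x01; rewrite /Gamma2 phiE// h1// h2//.
by rewrite mulf_div -expr2.
Qed.

End translate.

End geodesic.

(** * Time derivatives of the primitives, energy, and critical times *)

Section energy.
Context {R : realType}.
Local Notation mu := (@lebesgue_measure R).
Variables v0 r0 : R -> R.
Hypotheses (L2v : L2S v0) (L2r : L2S r0).
Hypothesis V1 : \int[mu]_(x in `[0, 1]) v0 x = 0.
Hypothesis W1 : \int[mu]_(x in `[0, 1]) energy_density v0 r0 x = 4.
Local Notation phi_x := (phi_x v0 r0).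
Local Notation phi_xt := (phi_xt v0 r0).
Local Notation kinetic := (kinetic v0 r0).

(** At fixed [x] the primitive is a trigonometric polynomial in time whose coefficients are [x] and
    two constants. *)
Lemma is_derive_prim_phi_x (x t : R) : x \in `[0, 1] ->
  is_derive t 1 (fun s => prim (phi_x s) x) (prim (phi_xt t) x).
Proof.
move=> x01.
have -> : (fun s => prim (phi_x s) x) = (fun s => cos s ^+ 2 * x +
    cos s * sin s * prim v0 x + sin s ^+ 2 / 4 * prim (energy_density v0 r0) x).
  by apply/funext => s; rewrite /phi_x prim_comb.
rewrite /phi_xt prim_comb//.
by apply: is_derive_eq; rewrite /GRing.scale/=; field.
Qed.

Lemma is_derive_prim_phi_xt (x t : R) : x \in `[0, 1] ->
  is_derive t 1 (fun s => prim (phi_xt s) x) (2 * prim (kinetic t) x - 2 * prim (phi_x t) x).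
Proof.
move=> x01.
have -> : (fun s => prim (phi_xt s) x) = (fun s => - 2 * (cos s * sin s) * x +
    (cos s ^+ 2 - sin s ^+ 2) * prim v0 x +
    sin s * cos s / 2 * prim (energy_density v0 r0) x).
  by apply/funext => s; rewrite /phi_xt prim_comb.
rewrite /phi_x /kinetic !prim_comb//.
by apply: is_derive_eq; rewrite /GRing.scale/=; field.
Qed.

Lemma metricA_geodesic t (phi U F : R -> R) :
  {in `[0, 1], phi =1 prim (phi_x t)} -> {in `[0, 1], U =1 prim (phi_xt t)} ->
  aeS (fun x => F x = r0 x / phi_x t x) ->
  (metricA phi U F U F =
   \int[mu]_x (if phi_x t x == 0 then 0 else kinetic t x)%:E)%E.
Proof.
move=> phiE UE FE; rewrite /metricA.
have mPQ : measurable_fun setT (fun x => if phi_x t x == 0 then 0 else kinetic t x).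
  apply: measurable_fun_ifT => //.
  - by apply: measurable_fun_eqr => //; exact: measurable_phi_x.
  - exact: measurable_comb.
transitivity ((4^-1)%:E * \int[mu]_x (4%:E * (if phi_x t x == 0 then 0 else kinetic t x)%:E))%E.
  congr (_ * _)%E; apply: ae_restrict_eq_integral.
  apply: ae_mono2 (ae_differentiation_point _ _ L2v L2r) FE => x h1 h2.
  rewrite patch_setT patchE.
  have [x01|x01] := boolP (x \in `[0, 1]); last first.
    rewrite /phi_x comb_out// eqxx mule0 memNset//= => -[].
    by move/negP : x01.
  have dx := h1 x01.
  have dphi := is_derive_prim_comb _ _ L2v L2r _ _ _ _ _ dx phiE.
  have dU := is_derive_prim_comb _ _ L2v L2r _ _ _ _ _ dx UE.
  have phi'E : derive1 phi x = phi_x t x.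
    by rewrite derive1E; exact: (@derive_val _ _ _ _ _ _ _ dphi).
  have U'E : derive1 U x = phi_xt t x.
    by rewrite derive1E; exact: (@derive_val _ _ _ _ _ _ _ dU).
  (* At a differentiation point, membership in [critical_set] is the same as the vanishing of
     [phi_x]. *)
  have [Px|Px] := eqVneq (phi_x t x) 0.
    rewrite mule0 memNset//= => -[_]; apply; split; [exact: x01| |by rewrite phi'E].
    exact: (@ex_derive _ _ _ _ _ _ _ dphi).
  rewrite mem_set/=; last by split => // -[_ _]; rewrite phi'E => /eqP; rewrite (negbTE Px).
  rewrite phi'E U'E h2// -EFinM; congr EFin.
  have := phi_xt_div_sqr v0 r0 L2r t x; rewrite (negbTE Px) => <-.
  by rewrite mulrDl; congr (_ + _); rewrite ?expr2; field.
rewrite ge0_integralZl//; last 2 first.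
- exact/measurable_EFinP.
- by move=> x _; rewrite lee_fin; case: ifP => // _; exact: kinetic_ge0.
by rewrite muleA -EFinM mulVf// mul1e.
Qed.

Lemma integral_kinetic_noncritical t :
  (\int[mu]_x (if phi_x t x == 0 then 0 else kinetic t x)%:E =
   if (sin t == 0)%R then 1
   else 1 - ((sin t ^+ 2)^-1)%:E *
            mu [set x : R | x \in `[0, 1] /\ phi_x t x = 0]%R)%E.
Proof.
(* If sin t = 0, then phi_x = cos^2 t = 1 on the unit interval and nothing is critical. *)
have [s0|s0] := eqVneq (sin t) 0.
  rewrite -(integral_kinetic _ _ L2v L2r V1 W1 t); apply: eq_integral => x _.
  case: eqP => // Px; have [x01|x01] := boolP (x \in `[0, 1]); last first.
    by rewrite /kinetic comb_out.
  move: Px; rewrite /phi_x /comb indicE mem_setE x01 s0 mul1r mulr0 !mul0r addr0 expr0n/= !mul0r addr0.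
  by move=> c0; have := cos2Dsin2 t; rewrite s0 c0 expr0n addr0 => /esym/eqP; rewrite oner_eq0.
set Z := [set x | _].
have mZ : measurable Z.
  have -> : Z = `[0, 1]%classic `&` (phi_x t @^-1` [set 0]) by [].
  apply: measurableI => //; rewrite -[X in measurable X]setTI.
  exact: (measurable_phi_x _ _ L2v L2r t).
have muZ : (mu Z < +oo)%E.
  rewrite (@le_lt_trans _ _ (mu `[0, 1]%classic))//; last first.
    by rewrite lebesgue_measure_itv/= lte_fin ltr01 -EFinB ltry.
  by apply: le_measure; rewrite ?inE//= => x [].
set E := (\int[_]_x _)%E.
have mPQ : measurable_fun setT (fun x => if phi_x t x == 0 then 0 else kinetic t x).
  apply: measurable_fun_ifT => //.
  - by apply: measurable_fun_eqr => //; exact: measurable_phi_x.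
  - exact: measurable_comb.
have EZ : (1 = E + ((sin t ^+ 2)^-1)%:E * mu Z)%E.
  rewrite -(integral_kinetic _ _ L2v L2r V1 W1 t).
  have -> : (mu Z = \int[mu]_x (\1_Z x)%:E)%E by rewrite integral_indic// setIT.
  have mi : measurable_fun setT (\1_Z : R -> R) by exact: measurable_indic.
  rewrite -ge0_integralZl//; last 2 first.
  - exact/measurable_EFinP.
  - by rewrite lee_fin invr_ge0 sqr_ge0.
  rewrite -ge0_integralD//.
  - apply: eq_integral => x _; rewrite -EFinM -EFinD; congr EFin.
    have [x01|x01] := boolP (x \in `[0, 1]); last first.
      by rewrite /kinetic /phi_x !comb_out// eqxx indicE memNset ?mulr0 ?addr0//= => -[]; move/negP: x01.
    case: eqP => Px; last by rewrite indicE memNset ?mulr0 ?addr0//= => -[].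
    rewrite indicE mem_set// mulr1 add0r kineticE//.
    have /eqP := Px; rewrite phi_xE// speed_eq0 => /andP[/eqP ca /eqP b0].
    have aE : v0 x / 2 = - (cos t / sin t).
      apply: (mulIf s0); rewrite mulNr divfK//; apply/eqP.
      by rewrite -addr_eq0 addrC ca.
    rewrite /speed_t b0 aE mul0r expr0n/= addr0.
    have -> : - (cos t / sin t) * cos t - sin t = - ((cos t ^+ 2 + sin t ^+ 2) / sin t) by field.
    by rewrite cos2Dsin2 sqrrN expr_div_n expr1n div1r.
  - by move=> x _; rewrite lee_fin; case: ifP => // _; exact: kinetic_ge0.
  - exact/measurable_EFinP.
  - by move=> x _; rewrite mule_ge0// lee_fin invr_ge0 sqr_ge0.
  - by apply: emeasurable_funM => //; exact/measurable_EFinP.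
rewrite EZ addeK//.
by rewrite fin_numM// ge0_fin_numE.
Qed.

Lemma ae_time_noncritical :
  {ae mu, forall t, {ae mu, forall x, x \in `[0, 1] -> phi_x t x != 0}}.
Proof.
pose A := [set p : R * R | p.2 \in `[0, 1] /\ phi_x p.1 p.2 = 0].
have [mv _ _] := L2v; have [mr _ _] := L2r.
have m1 : measurable_fun setT (fun p : R * R => cos p.1).
  apply: (measurableT_comp (f := cos)); last exact: measurable_fst.
  by apply: continuous_measurable_fun; exact: continuous_cos.
have m2 : measurable_fun setT (fun p : R * R => sin p.1).
  apply: (measurableT_comp (f := sin)); last exact: measurable_fst.
  by apply: continuous_measurable_fun; exact: continuous_sin.
have m3 : measurable_fun setT (fun p : R * R => v0 p.2).
  exact: (measurableT_comp mv measurable_snd).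
have m4 : measurable_fun setT (fun p : R * R => r0 p.2).
  exact: (measurableT_comp mr measurable_snd).
have m5 : measurable_fun setT (fun p : R * R => (\1_(`[0, 1]%classic) : R -> R) p.2).
  have mi : measurable_fun setT (\1_(`[0, 1]%classic) : R -> R).
    by apply: measurable_indic; exact: measurable_itv.
  exact: (measurableT_comp mi measurable_snd).
have mG : measurable_fun setT (fun p : R * R => phi_x p.1 p.2).
  apply: measurable_funM => //.
  apply: measurable_funD; first apply: measurable_funD.
  - exact: measurable_funX.
  - by apply: measurable_funM => //; exact: measurable_funM.
  - apply: measurable_funM; first by apply: measurable_funM => //; exact: measurable_funX.
    by apply: measurable_funD; exact: measurable_funX.
have mA : measurable A.
  have -> : A = (snd @^-1` `[0, 1]%classic) `&` ((fun p => phi_x p.1 p.2) @^-1` [set 0]) by [].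
  apply: measurableI; rewrite -[X in measurable X]setTI.
    by apply: (@measurable_snd _ _ R R) => //; exact: measurable_itv.
  by apply: mG => //; exact: measurable_set1.
have mf : measurable_fun setT (EFin \o (\1_A : R * R -> R)).
  by apply/measurable_EFinP; exact: measurable_indic.
have f0 p : (0 <= (EFin \o (\1_A : R * R -> R)) p)%E by rewrite lee_fin.
have := @fubini_tonelli _ _ _ _ R mu mu _ mf f0.
(* The section of [A] at a fixed [x] lies in the zero set of [speed], which is null; Tonelli
   transfers this to almost every time. *)
have zero x : (\int[mu]_t ((EFin \o (\1_A : R * R -> R)) (t, x)) = 0)%E.
  rewrite -[RHS](integral0 mu setT); apply: ae_eq_integral_nonmeas.
  apply: ae_mono (ae_speed_neq0 (v0 x / 2) (r0 x / 2)) => t /eqP h _ /=.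
  by rewrite indicE memNset//= => -[x01]; rewrite phi_xE.
under [RHS]eq_integral do rewrite zero.
rewrite integral0 => h.
have mF := @measurable_fun_fubini_tonelli_F _ _ _ _ R mu _ mf f0.
have : (\int[mu]_t `|fubini_F mu (EFin \o (\1_A : R * R -> R)) t| = 0)%E.
  rewrite -[RHS]h; apply: eq_integral => t _.
  by rewrite gee0_abs//; apply: integral_ge0.
move/ae_eq_integral_abs => /(_ measurableT mF) hF.
apply: ae_mono hF => t /(_ Logic.I) Ft0.
have mt : measurable_fun setT (fun x => (\1_A (t, x))%:E : \bar R).
  exact: (measurableT_comp mf (measurable_pair1 t)).
have : (\int[mu]_x `|(\1_A (t, x))%:E| = 0 :> \bar R)%E.
  by rewrite -[RHS]Ft0; apply: eq_integral => x _; rewrite gee0_abs.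
move/ae_eq_integral_abs => /(_ measurableT mt); apply: ae_mono => x /(_ Logic.I) + x01.
rewrite indicE; case: (boolP ((t, x) \in A)) => [_ []/eqP|]; first by rewrite oner_eq0.
by move=> /negP hA _; apply/eqP => Px; apply: hA; rewrite inE.
Qed.

End energy.

(** * From the Borel representatives back to the given data *)

Section geodesic_link.
Context {R : realType}.
Local Notation mu := (@lebesgue_measure R).
Variables v rho v0 r0 : R -> R.
Hypotheses (L2v : L2S v0) (L2r : L2S r0).
Hypotheses (vv0 : aeS (fun x => v x = v0 x)) (rr0 : aeS (fun x => rho x = r0 x)).
Hypothesis V1 : \int[mu]_(x in `[0, 1]) v0 x = 0.
Hypothesis W1 : \int[mu]_(x in `[0, 1]) energy_density v0 r0 x = 4.
Local Notation phi_x := (phi_x v0 r0).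
Local Notation phi_xt := (phi_xt v0 r0).
Local Notation kinetic := (kinetic v0 r0).

(** Free of the time, so at a regular point the formulas below hold for all times together and may
    be integrated and differentiated in [t]. *)
Definition regular_point (x : R) : Prop :=
  [/\ differentiation_point v0 r0 x, v x = v0 x & rho x = r0 x].

Lemma ae_regular_point : aeS regular_point.
Proof.
apply: ae_mono2 (ae_and _ _ vv0 rr0) (ae_differentiation_point _ _ L2v L2r).
by move=> x [h1 h2] h3 x01; split; [exact: h3|exact: h1|exact: h2].
Qed.

Lemma regular_itv x : regular_point x -> x \in `[0, 1].
Proof. by move=> [[/andP[x0 x1] _ _] _ _]; rewrite in_itv/= !ltW. Qed.

Lemma geo_phiE t : {in `[0, 1], geo_phi v rho t =1 prim (phi_x t)}.
Proof.
move=> x x01; apply: prim_ext; last by rewrite (itvP x01).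
apply: ae_mono2 vv0 rr0 => y h1 h2 y01.
by rewrite phi_xE// /geo_f /geo_g h1// h2.
Qed.

Lemma geo_phi_tderivable x t : x \in `[0, 1] -> 0 <= t ->
  tderivable (fun s => geo_phi v rho s x) t.
Proof.
move=> x01 t0; apply: (tderivable_is_derive _ _ _ _ t0 _ (is_derive_prim_phi_x _ _ L2v L2r x t x01)).
by move=> s _; exact: geo_phiE.
Qed.

Lemma geo_phi_tE t : 0 <= t -> {in `[0, 1], geo_phi_t v rho t =1 prim (phi_xt t)}.
Proof.
move=> t0 x x01.
apply: (Dt_is_derive _ _ _ _ t0 _ (is_derive_prim_phi_x _ _ L2v L2r x t x01)).
by move=> s _; exact: geo_phiE.
Qed.

Lemma geo_phi_t_tderivable x t : x \in `[0, 1] -> 0 <= t ->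
  tderivable (fun s => geo_phi_t v rho s x) t.
Proof.
move=> x01 t0; apply: (tderivable_is_derive _ _ _ _ t0 _ (is_derive_prim_phi_xt _ _ L2v L2r x t x01)).
by move=> s s0; exact: geo_phi_tE.
Qed.

Lemma geo_phi_ttE t x : 0 <= t -> x \in `[0, 1] ->
  geo_phi_tt v rho t x = 2 * prim (kinetic t) x - 2 * prim (phi_x t) x.
Proof.
move=> t0 x01.
apply: (Dt_is_derive _ _ _ _ t0 _ (is_derive_prim_phi_xt _ _ L2v L2r x t x01)).
by move=> s s0; exact: geo_phi_tE.
Qed.

Lemma geo_phi_xE s x : regular_point x ->
  geo_phi_x v rho s x = speed (v0 x / 2) (r0 x / 2) s.
Proof.
move=> xr; have [dx _ _] := xr; rewrite -phi_xE; last exact: regular_itv.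
have dphi := is_derive_prim_comb _ _ L2v L2r _ _ _ _ _ dx (geo_phiE s).
by rewrite /geo_phi_x derive1E; exact: (@derive_val _ _ _ _ _ _ _ dphi).
Qed.

(** It holds at critical times too, since the inverse of 0 is 0, as the indicator requires. *)
Lemma geo_integrandE s x : regular_point x ->
  geo_integrand v rho x s = (speed (v0 x / 2) (r0 x / 2) s)^-1.
Proof.
move=> xr; rewrite /geo_integrand geo_phi_xE// indicE.
have [x0|x0] := eqVneq (speed (v0 x / 2) (r0 x / 2) s) 0.
  by rewrite x0 invr0 mulr0.
by rewrite mem_set ?mul1r//= geo_phi_xE// lt0r x0 speed_ge0.
Qed.

Lemma geo_integrand_integrable x t : regular_point x -> rho x != 0 ->
  mu.-integrable `[0, t] (fun s => (geo_integrand v rho x s)%:E).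
Proof.
move=> xr rx; have [_ _ rE] := xr.
rewrite (_ : (fun s => _) = EFin \o (fun s => (speed (v0 x / 2) (r0 x / 2) s)^-1)); last first.
  by apply/funext => s; rewrite geo_integrandE.
apply: continuous_compact_integrable; first exact: segment_compact.
apply: continuous_subspaceT; apply: continuous_inv_speed.
by rewrite -rE mulf_neq0// invr_eq0.
Qed.

(** Twice the angle swept by f + i g, with the sign of [r0 x]; the value is 0 where [r0 x]
    vanishes. *)
Definition vrho_angle (t x : R) : R :=
  r0 x * ((angle (v0 x / 2) `|r0 x / 2| t - angle (v0 x / 2) `|r0 x / 2| 0) / `|r0 x / 2|).

Lemma geo_vrhoE t x : regular_point x -> 0 <= t ->
  geo_vrho v rho t x = vrho_angle t x.
Proof.
move=> xr t0; have [_ _ rE] := xr; rewrite /geo_vrho /vrho_angle rE.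
have [->|rx] := eqVneq (r0 x) 0; first by rewrite !mul0r.
congr (_ * _); under eq_Rintegral do rewrite geo_integrandE//.
by rewrite integral_inv_speed// mulf_neq0// invr_eq0.
Qed.

Lemma is_derive_vrho_angle (t x : R) :
  is_derive t 1 (vrho_angle^~ x) (r0 x / speed (v0 x / 2) (r0 x / 2) t).
Proof.
rewrite /vrho_angle.
have [->|rx] := eqVneq (r0 x) 0.
  rewrite [X in is_derive _ _ X](_ : _ = cst (0 : R)); last by apply/funext => s; rewrite mul0r.
  by rewrite mul0r; exact: is_derive_cst.
have b0 : 0 < `|r0 x / 2| by rewrite normr_gt0 mulf_neq0// invr_eq0.
have h := is_derive_angle (v0 x / 2) _ t b0.
apply: is_derive_eq; rewrite /GRing.scale/= speed_norm.
field; rewrite (gt_eqF b0) andbT gt_eqF// speed_gt0//.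
by rewrite mulf_neq0// invr_eq0.
Qed.

Lemma geo_vrho_tderivable t x : regular_point x -> 0 <= t ->
  tderivable (fun s => geo_vrho v rho s x) t.
Proof.
move=> xr t0; apply: (tderivable_is_derive _ _ _ _ t0 _ (is_derive_vrho_angle t x)).
by move=> s s0; exact: geo_vrhoE.
Qed.

Lemma geo_vrho_tE t x : regular_point x -> 0 <= t ->
  geo_vrho_t v rho t x = r0 x / speed (v0 x / 2) (r0 x / 2) t.
Proof.
move=> xr t0; apply: (Dt_is_derive _ _ _ _ t0 _ (is_derive_vrho_angle t x)).
by move=> s s0; exact: geo_vrhoE.
Qed.

Lemma is_derive_vrho_speed (t x : R) :
  is_derive t 1 (fun s => r0 x / speed (v0 x / 2) (r0 x / 2) s)
    (- (speed' (v0 x / 2) (r0 x / 2) t * r0 x / speed (v0 x / 2) (r0 x / 2) t ^+ 2)).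
Proof.
(* When [r0 x] is 0, [speed] may vanish at some times, but the quotient is constantly 0. *)
have [->|rx] := eqVneq (r0 x) 0.
  rewrite [X in is_derive _ _ X](_ : _ = cst (0 : R)); last by apply/funext => s; rewrite mul0r.
  by rewrite mulr0 mul0r oppr0; exact: is_derive_cst.
have P0 : speed (v0 x / 2) (r0 x / 2) t != 0.
  by rewrite gt_eqF// speed_gt0// mulf_neq0// invr_eq0.
have h := is_derive_speed (v0 x / 2) (r0 x / 2) t.
have h2 := @is_deriveV R (speed (v0 x / 2) (r0 x / 2)) t _ 1 P0 h.
apply: is_derive_eq; rewrite /GRing.scale/=.
by field.
Qed.

Lemma geo_vrho_t_tderivable t x : regular_point x -> 0 <= t ->
  tderivable (fun s => geo_vrho_t v rho s x) t.
Proof.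
move=> xr t0; apply: (tderivable_is_derive _ _ _ _ t0 _ (is_derive_vrho_speed t x)).
by move=> s s0; exact: geo_vrho_tE.
Qed.

Lemma geo_vrho_ttE t x : regular_point x -> 0 <= t ->
  geo_vrho_tt v rho t x = - (phi_xt t x * r0 x / phi_x t x ^+ 2).
Proof.
move=> xr t0; rewrite phi_xtE ?phi_xE; try exact: regular_itv.
apply: (Dt_is_derive _ _ _ _ t0 _ (is_derive_vrho_speed t x)).
by move=> s s0; exact: geo_vrho_tE.
Qed.

Lemma ae_geo_vrho_t t : 0 <= t -> aeS (fun x => geo_vrho_t v rho t x = r0 x / phi_x t x).
Proof.
move=> t0; apply: ae_mono ae_regular_point => x h x01.
by rewrite geo_vrho_tE// ?phi_xE//; exact: h.
Qed.

Lemma MAC_geo_phi t : MAC (geo_phi v rho t).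
Proof.
have mP := measurable_phi_x _ _ L2v L2r t; have P0 := phi_x_ge0 v0 r0 t.
have Pout := phi_x_out v0 r0 t.
have P1 := integral_phi_x _ _ L2v L2r V1 W1 t.
have h0 : (0 : R) \in `[0, 1] by rewrite in_itv/= lexx ler01.
have h1 : (1 : R) \in `[0, 1] by rewrite in_itv/= lexx ler01.
split.
- by move=> x x01; rewrite geo_phiE//; exact: prim_itv.
- move=> x y x01 y01 xy; rewrite !geo_phiE//; exact: (prim_nd _ mP P0 Pout P1).
- move=> e e0.
  have iP : mu.-integrable setT (EFin \o phi_x t) by exact: integrable_comb.
  have [d d0 hd] := absolutely_continuous_prim _ iP e e0.
  exists d => // n a b hab disj sumd.
  rewrite (eq_bigr (fun i => `|prim (phi_x t) (b i) - prim (phi_x t) (a i)|)).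
    exact: (hd n a b hab disj sumd).
  move=> i _; have [a0 [ab b1]] := hab i.
  by rewrite !geo_phiE// in_itv/=; apply/andP; split => //; lra.
- by rewrite geo_phiE// /prim set_itv1 Rintegral_set1.
- by rewrite geo_phiE// (prim1 _ mP P0 Pout P1).
Qed.

Lemma measurable_vrho_angle t : measurable_fun setT (vrho_angle t).
Proof.
have [mv _ _] := L2v; have [mr _ _] := L2r.
have ma : measurable_fun setT (fun x => v0 x / 2) by exact: measurable_funM.
have mb : measurable_fun setT (fun x => `|r0 x / 2|).
  by apply: measurableT_comp => //; exact: measurable_funM.
have mangle s : measurable_fun setT (fun x => angle (v0 x / 2) `|r0 x / 2| s).
  have mS : measurable_fun setT (fun x => speed (v0 x / 2) `|r0 x / 2| s).
    apply: measurable_funD; apply: measurable_funX.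
      by apply: measurable_funD => //; exact: measurable_funM.
    exact: measurable_funM.
  have mS' : measurable_fun setT (fun x => speed' (v0 x / 2) `|r0 x / 2| s).
    apply: measurable_funD; last first.
      by apply: measurable_funM => //; apply: measurable_funM => //; exact: measurable_funX.
    apply: measurable_funM.
      by apply: measurable_funM => //; apply: measurable_funD => //; exact: measurable_funM.
    by apply: measurable_funB => //; exact: measurable_funM.
  apply: measurable_funD => //.
  apply: (measurableT_comp (f := @atan R)).
    by apply: continuous_measurable_fun => x; exact: continuous_atan.
  apply: measurable_funM => //; apply: measurable_funV.
  by apply: measurable_funM => //; exact: measurable_funD.
apply: measurable_funM => //; apply: measurable_funM; last exact: measurable_funV.
exact: measurable_funB.
Qed.

(** The division by [r0 x / 2] cancels against the prefactor, so the bound is uniform in [x] however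
    small [r0 x] is; square integrability follows at once. *)
Lemma vrho_angle_le t x : 0 <= t -> `|vrho_angle t x| <= 2 * (t + pi).
Proof.
move=> t0; have := angle_le (v0 x / 2) `|r0 x / 2| _ t0; rewrite /vrho_angle.
set A := _ - _ => hA.
have [->|rx] := eqVneq (r0 x) 0.
  by rewrite mul0r normr0 mulr_ge0// addr_ge0// pi_ge0.
rewrite normrM [`|A / _|]normrM normfV normr_id [`|r0 x / 2|]normrM.
rewrite (ger0_norm (_ : 0 <= 2^-1 :> R))//.
have -> : `|r0 x| * (`|A| / (`|r0 x| / 2)) = 2 * `|A|.
  by field; rewrite normr_eq0.
by rewrite ler_wpM2l.
Qed.

Lemma H0_geo_vrho t : 0 <= t -> H0 (geo_vrho v rho t).
Proof.
move=> t0.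
have mu01 : (mu (`[0%R, 1%R]%classic : set R) < +oo)%E.
  by rewrite lebesgue_measure_itv/= lte_fin ltr01 -EFinB ltry.
exists (vrho_angle t); split.
- by apply: measurable_funTS; exact: measurable_vrho_angle.
- apply: measurable_bounded_integrable => //.
  + by apply: measurable_funTS; apply: measurable_funX; exact: measurable_vrho_angle.
  + exists ((2 * (t + pi)) ^+ 2); split; first exact: num_real.
    move=> M hM x _ /=; rewrite normrX (le_trans _ (ltW hM))//.
    by rewrite lerXn2r ?nnegrE ?vrho_angle_le// mulr_ge0// addr_ge0// pi_ge0.
- by apply: ae_mono ae_regular_point => x h x01; rewrite geo_vrhoE//; exact: h.
Qed.

Lemma geo_energyE t : 0 <= t -> (geo_energy v rho t =
   if (sin t == 0)%R then 1
   else 1 - ((sin t ^+ 2)^-1)%:E *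
     mu [set x : R | x \in `[0, 1] /\ phi_x t x = 0]%R)%E.
Proof.
move=> t0; rewrite /geo_energy (metricA_geodesic _ _ L2v L2r t).
- exact: integral_kinetic_noncritical.
- exact: geo_phiE.
- exact: geo_phi_tE.
- exact: ae_geo_vrho_t.
Qed.

(** At time 0 phi agrees with [id] on the unit interval, which is all that [metricA_geodesic] asks
    of it. *)
Lemma initial_energy : metricA id (geo_phi_t v rho 0) (geo_vrho_t v rho 0)
  (geo_phi_t v rho 0) (geo_vrho_t v rho 0) = 1%E.
Proof.
have h01 := lexx (0 : R).
have idE : {in `[0, 1], (id : R -> R) =1 prim (phi_x 0)}.
  move=> x x01; rewrite /phi_x prim_comb// cos0 sin0 expr1n expr0n/=.
  by rewrite mulr0 !mul0r !addr0 mul1r.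
rewrite (metricA_geodesic _ _ L2v L2r 0 id)//.
- by rewrite integral_kinetic_noncritical// sin0 eqxx.
- exact: geo_phi_tE.
- exact: ae_geo_vrho_t.
Qed.

Lemma critical_measure t : sin t != 0 ->
  mu [set x : R | x \in `[0, 1] /\ phi_x t x = 0] =
  mu [set x : R | [/\ x \in `[0, 1], v x = - 2 * (cos t / sin t) & rho x = 0]].
Proof.
move=> s0; apply: lebesgue_measure_ae; apply: ae_mono2 vv0 rr0 => x h1 h2 /=.
have crit : x \in `[0, 1] -> (phi_x t x == 0) = (v x == - 2 * (cos t / sin t)) && (rho x == 0).
  move=> x01; rewrite phi_xE// speed_eq0 h1// h2// mulf_eq0 invr_eq0 [2 == 0]pnatr_eq0 orbF.
  congr (_ && _); apply/eqP/eqP => h.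
    apply: (mulIf s0); rewrite -mulrA divfK//.
    have -> : v0 x * sin t = 2 * (v0 x / 2 * sin t) by field.
    have -> : v0 x / 2 * sin t = - cos t by apply/eqP; rewrite -addr_eq0 addrC h.
    by ring.
  by rewrite h; field.
split.
  by move=> [x01 /eqP]; rewrite crit// => /andP[/eqP ? /eqP ?].
by move=> [x01 /eqP hv /eqP hr]; split => //; apply/eqP; rewrite crit// hv hr.
Qed.

End geodesic_link.

Theorem theorem4p1 (R : realType) (u v rho : R -> R) :
  H1 u v -> u 0 = 0 -> H0 rho -> sqnormH0 v + sqnormH0 rho = 4 ->
  [/\
   (* (i) *)
   forall t : R, 0 <= t ->
     aeS (fun x => rho x != 0 ->
       lebesgue_measure.-integrable `[0, t]
         (fun s => (geo_integrand v rho x s)%:E)) /\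
     M0AC (geo_phi v rho t) (geo_vrho v rho t),
   (* (ii) *)
   forall t : R, 0 <= t ->
     [/\ forall x, x \in `[0, 1] -> tderivable (fun s => geo_phi v rho s x) t,
         aeS (fun x => tderivable (fun s => geo_vrho v rho s x) t)
       & tangent (geo_phi v rho t) (geo_phi_t v rho t) (geo_vrho_t v rho t)],
   (* (iii) *)
   (forall t : R, 0 <= t ->
     geo_energy v rho t =
     if sin t == 0 then 1%E
     else (1 - ((sin t ^+ 2)^-1)%:E *
             lebesgue_measure
               [set x : R | [/\ x \in `[0, 1],
                                v x = - 2 * (cos t / sin t) & rho x = 0]%R])%E) /\
   {ae lebesgue_measure, forall t : R, 0 <= t ->
     geo_energy v rho t =
     metricA id (geo_phi_t v rho 0) (geo_vrho_t v rho 0)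
                (geo_phi_t v rho 0) (geo_vrho_t v rho 0)}
   & (* (iv) *)
   {ae lebesgue_measure, forall t : R, 0 <= t ->
     [/\ forall x, x \in `[0, 1] -> tderivable (fun s => geo_phi_t v rho s x) t,
         aeS (fun x => tderivable (fun s => geo_vrho_t v rho s x) t)
       & christoffel_eq (geo_phi v rho t)
           (geo_phi_t v rho t) (geo_vrho_t v rho t)
           (geo_phi_tt v rho t) (geo_vrho_tt v rho t)]}].
Proof.
move=> [_ _ H0v wdu] _ H0rho sq4.
have [v0 L2v vv0] := H0_L2S _ H0v; have [r0 L2r rr0] := H0_L2S _ H0rho.
have [_ _ iv2] := L2v; have [_ _ ir2] := L2r.
(* The constant 1 is an admissible test function for the weak derivative on the circle. *)
have V1 : \int[lebesgue_measure]_(x in `[0, 1]) v0 x = 0.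
  transitivity (\int[lebesgue_measure]_(x in `[0, 1]) (v x * 1)).
    by apply: ae_eq_Rintegral_nonmeas; apply: ae_mono vv0 => x h /h ->; rewrite mulr1.
  apply/eqP; rewrite -oppr_eq0 -(wdu _ (C1S_cst 1)) /Rintegral integral0_eq//.
  by move=> x _; rewrite derive1_cst mulr0.
have W1 : \int[lebesgue_measure]_(x in `[0, 1]) energy_density v0 r0 x = 4.
  rewrite /energy_density RintegralD//; [|exact: integrableS iv2|exact: integrableS ir2].
  rewrite -sq4; congr (_ + _); apply: ae_eq_Rintegral_nonmeas.
    by apply: ae_mono vv0 => x h /h ->.
  by apply: ae_mono rr0 => x h /h ->.
have tang t : 0 <= t -> tangent (geo_phi v rho t) (geo_phi_t v rho t) (geo_vrho_t v rho t).
  move=> t0; apply: (tangent_geodesic _ _ L2v L2r V1 W1 t).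
  - exact: geo_phiE.
  - exact: geo_phi_tE.
  - exact: ae_geo_vrho_t.
have aet := ae_time_noncritical _ _ L2v L2r.
split.
- move=> t t0; split; last by split; [exact: (MAC_geo_phi _ _ _ _ L2v L2r)|exact: (H0_geo_vrho _ _ _ _ L2v L2r)].
  apply: ae_mono (ae_regular_point _ _ _ _ L2v L2r vv0 rr0) => x h x01 rx.
  by apply: (geo_integrand_integrable _ _ _ _ L2v L2r vv0 rr0) => //; exact: h.
- move=> t t0; split; last exact: tang.
  + by move=> x x01; exact: (geo_phi_tderivable _ _ _ _ L2v L2r).
  + apply: ae_mono (ae_regular_point _ _ _ _ L2v L2r vv0 rr0) => x h x01.
    by apply: (geo_vrho_tderivable _ _ _ _ L2v L2r vv0 rr0) => //; exact: h.
- split.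
  + move=> t t0; rewrite (geo_energyE _ _ _ _ L2v L2r vv0 rr0 V1 W1 t t0).
    by case: eqP => // /eqP s0; rewrite (critical_measure _ _ _ _ vv0 rr0).
  + apply: ae_mono aet => t h t0.
    rewrite (initial_energy _ _ _ _ L2v L2r vv0 rr0 V1 W1).
    rewrite (geo_energyE _ _ _ _ L2v L2r vv0 rr0 V1 W1 t t0).
    case: ifPn => // s0.
    (* At a time with almost no critical points the defect of energy is the measure of a null
       set. *)
    rewrite (@lebesgue_measure_ae _ _ set0) ?measure0 ?mule0 ?sube0//.
    by apply: ae_mono h => x h; split => // -[/h /eqP].
- apply: ae_mono aet => t h t0; split.
  + by move=> x x01; exact: (geo_phi_t_tderivable _ _ _ _ L2v L2r).
  + apply: ae_mono (ae_regular_point _ _ _ _ L2v L2r vv0 rr0) => x h' x01.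
    by apply: (geo_vrho_t_tderivable _ _ _ _ L2v L2r vv0 rr0) => //; exact: h'.
  + split; first exact: tang.
    move=> u1 v1 r1 hrt.
    have phiE := geo_phiE _ _ _ _ vv0 rr0 t.
    have UE := geo_phi_tE _ _ _ _ L2v L2r vv0 rr0 t t0.
    have FE := ae_geo_vrho_t _ _ _ _ L2v L2r vv0 rr0 t t0.
    have [h1 h2] := christoffel_geodesic _ _ L2v L2r V1 W1 t _ _ _ phiE UE FE u1 v1 r1 h hrt.
    split.
      by move=> x x01; rewrite h1//; exact: (geo_phi_ttE _ _ _ _ L2v L2r).
    apply: ae_mono2 h2 (ae_regular_point _ _ _ _ L2v L2r vv0 rr0) => x h3 h4 x01.
    by rewrite h3//; apply: (geo_vrho_ttE _ _ _ _ L2v L2r vv0 rr0) => //; exact: h4.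
Qed.
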